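(* Let $r>s\ge 2$ be integers with $r-s\ge 2$, and let $H$ be a double-edge-critical graph with $\chi(H)=r+1$. Let $F_1$ and $F$ be edge-critical graphs satisfying \[ \chi(F_1)=r-s,\qquad \chi(F)=s+1,\qquad H\subseteq F_1+F . \] Then there exists $n_0=n_0(H,F_1,F,r,s)$ such that the following holds for all $n\ge n_0$. Let $G$ be an $H$-free graph on $n$ vertices. Suppose that $G$ contains a set $M\subseteq V(G)$ of size $m$ such that $G[M]$ is $F$-free and \[ m\ge \left\lceil \frac{sn}{r}\right\rceil . \] Put $q=n-m$ and $J_0=F_1+K_1$. Then \[ e(G)\le m(n-m)+t_s(m)+\operatorname{ex}(q,J_0). \] Consequently, there exists $q_0=q_0(F_1,r,s)$ (depending only on $F_1,r,s$) such that, whenever $n-m\ge q_0$, \[ e(G)\le m(n-m)+t_s(m)+t_{r-s}(n-m). \] In this latter range ($n-m\ge q_0$), equality in the last inequality holds if and only if $G$ is a complete $r$-partite graph whose parts can be divided into two groups: $s$ parts with total size $m$, as equal as possible, and $r-s$ parts with total size $n-m$, as equal as possible.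
   Context: All graphs are finite, simple and undirected; $e(G)$ is the number of edges of $G$, $\chi$ is the chromatic number, and $G[M]$ is the subgraph induced by $M\subseteq V(G)$. A graph is $F$-free if it contains no (not necessarily induced) subgraph isomorphic to $F$; $H\subseteq J$ means that $J$ contains a subgraph isomorphic to $H$. $\operatorname{ex}(q,J)$ is the maximum number of edges of a $J$-free graph on $q$ vertices. A graph is edge-critical (equivalently, color-critical) if it contains an edge whose deletion reduces its chromatic number. A graph $H$ is double-edge-critical if it contains two edges $e_1,e_2$ such that $\chi(H-\{e_1,e_2\})=\chi(H)-2$, where $H-\{e_1,e_2\}$ is obtained by deleting the two edges (keeping all vertices). For vertex-disjoint graphs $A,B$, the join $A+B$ is obtained from their disjoint union by adding all edges between $V(A)$ and $V(B)$. A graph is complete $r$-partite if its vertex set can be partitioned into $r$ independent sets (parts) such that every two vertices from distinct parts are adjacent; parts of size zero are allowed. ''As equal as possible'' means that the sizes of any two parts within the group differ by at most one. The Turán graph $T_r(n)$ is the complete $r$-partite graph on $n$ vertices in which any two part sizes differ by at most one, and $t_r(n)=e(T_r(n))$, with $t_r(0)=0$. *)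

(* Defs.v *)
From HB Require Import structures.
From mathcomp Require Import all_boot all_order all_algebra.
From mathcomp Require Import zify.

Set Implicit Arguments.
Unset Strict Implicit.
Unset Printing Implicit Defensive.

(* A graph on T is its set of edges, each of them a two-element subset of T,
   so the graphs on T form a finite type. *)
Record sgraph (T : finType) := SGraph {
  edges : {set {set T}};
  edges_card2 : [forall A in edges, #|A| == 2]
}.

HB.instance Definition _ (T : finType) := [isSub for @edges T].
HB.instance Definition _ (T : finType) := [Finite of sgraph T by <:].

Definition adj (T : finType) (G : sgraph T) : rel T :=
  fun x y => [set x; y] \in edges G.

Definition nb_edges (T : finType) (G : sgraph T) : nat := #|edges G|.

Section Basics.
Variable T : finType.
Implicit Types (G : sgraph T) (e : rel T).

Lemma adj_sym G : symmetric (adj G).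
Proof. by move=> x y; rewrite /adj setUC. Qed.

Lemma adj_irr G : irreflexive (adj G).
Proof.
move=> x; apply/negP => xG.
by have /forall_inP/(_ _ xG) := edges_card2 G; rewrite setUid cards1.
Qed.

Lemma sgraphP G1 G2 : adj G1 =2 adj G2 -> G1 = G2.
Proof.
move=> eqG; apply: val_inj; apply/setP => A /=.
have [/cards2P[x [y [_ ->]]]|nA2] := boolP (#|A| == 2); first exact: eqG.
have nin G : A \notin edges G.
  by apply: contra nA2 => AG; apply: (forall_inP (edges_card2 G)).
by rewrite (negPf (nin G1)) (negPf (nin G2)).
Qed.

Definition rel_edges e : {set {set T}} :=
  [set [set p.1; p.2] | p : T * T & (p.1 != p.2) && e p.1 p.2].

Lemma rel_edges_card2 e : [forall A in rel_edges e, #|A| == 2].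
Proof.
apply/forall_inP => A /imsetP[[x y]].
by rewrite inE /= => /andP[xy _] ->; rewrite cards2 xy.
Qed.

(* Loops of e are dropped and e is symmetrized; see adj_graph_of. *)
Definition graph_of e : sgraph T := SGraph (rel_edges_card2 e).

Lemma adj_graph_ofE e x y :
  adj (graph_of e) x y = (x != y) && (e x y || e y x).
Proof.
apply/imsetP/andP => [[[a b]] | [xy]].
  rewrite inE /= => /andP[ab eab] xyE.
  have xab : (x == a) || (x == b) by rewrite -in_set2 -xyE set21.
  have yab : (y == a) || (y == b) by rewrite -in_set2 -xyE set22.
  have axy : (a == x) || (a == y) by rewrite -in_set2 xyE set21.
  have bxy : (b == x) || (b == y) by rewrite -in_set2 xyE set22.
  case/orP: xab => /eqP xE; subst x.
    case/orP: yab => /eqP yE; subst y; last by rewrite ab eab.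
    by case/orP: bxy ab => /eqP->; rewrite eqxx.
  case/orP: yab => /eqP yE; subst y; first by rewrite eq_sym ab eab orbT.
  by case/orP: axy ab => /eqP->; rewrite eqxx.
case/orP=> exy.
  by exists (x, y) => //; rewrite inE /= xy exy.
by exists (y, x); [rewrite inE /= eq_sym xy exy | rewrite /= setUC].
Qed.

Lemma adj_graph_of e : symmetric e -> irreflexive e -> adj (graph_of e) =2 e.
Proof.
move=> esym eirr x y; rewrite adj_graph_ofE (esym y x) orbb.
by case: eqVneq => //= ->; rewrite eirr.
Qed.

Lemma del_edges_card2 G (D : {set {set T}}) :
  [forall A in edges G :\: D, #|A| == 2].
Proof.
apply/forall_inP => A /setDP[AG _].
exact: (forall_inP (edges_card2 G)).
Qed.

Definition del_edges G (D : {set {set T}}) : sgraph T :=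
  SGraph (del_edges_card2 G D).

Definition colorable G (k : nat) : bool :=
  [exists c : {ffun T -> 'I_k}, forall x, forall y, adj G x y ==> (c x != c y)].

Lemma colorable_card G : exists k, colorable G k.
Proof.
exists #|T|; apply/existsP; exists [ffun x => enum_rank x].
apply/forallP => x; apply/forallP => y; apply/implyP => xy.
rewrite !ffunE (inj_eq enum_rank_inj).
by apply: contraTneq xy => ->; rewrite adj_irr.
Qed.

Definition chi G : nat := ex_minn (colorable_card G).

Definition edge_critical G : Prop :=
  exists2 e : {set T}, e \in edges G & chi (del_edges G [set e]) < chi G.

(* The drop by 2 is stated additively, avoiding truncated subtraction. *)
Definition double_edge_critical G : Prop :=
  exists e1 e2 : {set T}, [/\ e1 \in edges G, e2 \in edges G, e1 != e2
    & chi (del_edges G [set e1; e2]) + 2 = chi G].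

End Basics.

Definition induced (T : finType) (G : sgraph T) (M : {set T}) :
  sgraph {x : T | x \in M} :=
  graph_of (fun x y => adj G (val x) (val y)).

Lemma adj_induced (T : finType) (G : sgraph T) (M : {set T})
    (x y : {x : T | x \in M}) :
  adj (induced G M) x y = adj G (val x) (val y).
Proof.
by rewrite adj_graph_of // => [? ?|?]; rewrite ?adj_irr // adj_sym.
Qed.

Definition subgraph (S T : finType) (H : sgraph S) (J : sgraph T) : bool :=
  [exists f : {ffun S -> T},
    injectiveb f && [forall x, forall y, adj H x y ==> adj J (f x) (f y)]].

Definition graph_free (S T : finType) (F : sgraph S) (G : sgraph T) : bool :=
  ~~ subgraph F G.

Definition join_rel (S T : finType) (A : sgraph S) (B : sgraph T) :
    rel (S + T) := fun u v =>
  match u, v with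
  | inl x, inl y => adj A x y
  | inr x, inr y => adj B x y
  | _, _ => true
  end.

Definition join (S T : finType) (A : sgraph S) (B : sgraph T) :
  sgraph (S + T)%type := graph_of (join_rel A B).

Lemma adj_join (S T : finType) (A : sgraph S) (B : sgraph T) :
  adj (join A B) =2 join_rel A B.
Proof.
apply: adj_graph_of => [[x|x] [y|y]|[x|x]] //=; rewrite ?adj_irr //;
  exact: adj_sym.
Qed.

Definition K1 : sgraph unit := graph_of (fun _ _ => false).

(* The maximum of an empty family would be 0; the family is nonempty as soon as
   J has an edge. *)
Definition ex_number (S : finType) (q : nat) (J : sgraph S) : nat :=
  \max_(G : sgraph 'I_q | graph_free J G) nb_edges G.

(* The fibres of c are the parts; c need not be surjective, so parts of size
   zero are allowed. *)
Definition complete_partite (T : finType) (G : sgraph T) (r : nat)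
    (c : T -> 'I_r) : Prop :=
  forall x y, adj G x y = (c x != c y).

Definition part_size (T : finType) (r : nat) (c : T -> 'I_r) (i : 'I_r) : nat :=
  #|[set x | c x == i]|.

Definition as_equal_as_possible (T : finType) (r : nat) (c : T -> 'I_r)
    (I : {set 'I_r}) : Prop :=
  forall i j, i \in I -> j \in I -> part_size c i <= (part_size c j).+1.

(* For 0 < r, the parts of turan r n are the residue classes modulo r; turan_spec
   checks that they are as equal as possible. *)
Definition turan (r n : nat) : sgraph 'I_n :=
  graph_of (fun x y : 'I_n => x %% r != y %% r).

Definition t_ (r n : nat) : nat := nb_edges (turan r n).

Lemma adj_turan r n (x y : 'I_n) : adj (turan r n) x y = (x %% r != y %% r).
Proof. by rewrite adj_graph_of // => [u v|u]; rewrite ?eqxx // eq_sym. Qed.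

Lemma turan_spec r n : 0 < r ->
  exists c : 'I_n -> 'I_r,
    complete_partite (turan r n) c /\ as_equal_as_possible c setT.
Proof.
move=> r0; pose c (x : 'I_n) := Ordinal (ltn_pmod x r0).
exists c; split=> [x y|i j _ _]; first by rewrite adj_turan.
rewrite /part_size.
(* Apart from its least element i, the part i injects into the part j by
   x |-> x - r + (j - i). *)
pose A : {set 'I_n} := [set x in [set x | c x == i] | i < x].
pose f (x : 'I_n) : 'I_n := insubd x (x - i - r + j).
have cE (k : 'I_r) (x : 'I_n) : (c x == k) = (x %% r == k) by [].
have fE x : x \in A -> f x = x - i - r + j :> nat /\ r + i <= x.
  rewrite !inE cE => /andP[/eqP xi ltix].
  have rix : r + i <= x.
    rewrite (divn_eq x r) xi leq_add2r leq_pmull // lt0n.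
    by apply: contraTneq ltix => q0; rewrite (divn_eq x r) q0 xi ltnn.
  split=> //; rewrite val_insubd ifT //; apply: leq_ltn_trans (ltn_ord x).
  by have := ltn_ord j; lia.
have fj x : x \in A -> f x \in [set x | c x == j].
  move=> xA; have [fx rix] := fE x xA; rewrite inE cE fx.
  move: xA; rewrite !inE cE => /andP[/eqP xi _].
  have q1 : 0 < x %/ r by rewrite divn_gt0 // (leq_trans _ rix) ?leq_addr.
  have -> : x - i - r = (x %/ r).-1 * r.
    by rewrite {1}(divn_eq x r) xi addnK -subn1 mulnBl mul1n.
  by rewrite modnMDl modn_small.
have finj : {in A &, injective f}.
  move=> x y xA yA fxy; apply: val_inj => /=.
  have [fx rx] := fE x xA; have [fy ry] := fE y yA.
  by move: fx; rewrite fxy fy; lia.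
have leA : #|A| <= #|[set x | c x == j]|.
  rewrite -(card_in_imset finj); apply: subset_leq_card.
  by apply/subsetP => _ /imsetP[x xA ->]; exact: fj.
rewrite -addn1 -(cardsID A [set x | c x == i]) leq_add //.
  by rewrite (leq_trans _ leA) // subset_leq_card // subsetIr.
apply/card_le1_eqP => x y; rewrite !inE !cE => /andP[nx xi] /andP[ny yi].
have small (z : 'I_n) : ~~ ((z %% r == i) && (i < z)) -> z %% r == i ->
    z = i :> nat.
  move=> + /eqP zi; rewrite zi eqxx /= -leqNgt => lezi.
  by apply/eqP; rewrite eqn_leq lezi -{1}zi leq_mod.
by apply: val_inj; rewrite /= (small x nx xi) (small y ny yi).
Qed.

(* Only the total size of the s parts is prescribed: they need not cover a given
   vertex set of that size. *)
Definition two_group_partite (T : finType) (G : sgraph T) (r s m : nat) : Prop :=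
  exists (c : T -> 'I_r) (I : {set 'I_r}),
    [/\ complete_partite G c,
        #|I| = s /\ #|~: I| = r - s,
        \sum_(i in I) part_size c i = m /\
          \sum_(i in ~: I) part_size c i = #|T| - m,
        as_equal_as_possible c I
      & as_equal_as_possible c (~: I)].

(* Main.v *)
Require Import Defs.
From mathcomp Require Import all_boot all_order all_algebra.
From mathcomp Require Import perm zify ring.

(* Put p = r - s and count nonadjacent ordered pairs N(U) instead of edges: the
   target becomes N(V) >= sq s m + sq p q, where sq k n is the least sum of k
   squares of total n.  The argument is a progressive induction on vertex sets U.
   Take the largest k for which U contains a complete k-partite graph S with large
   parts, each inside or outside M, and delete S.  If k < r, few vertices have many
   neighbours in every part, so N - (sq s m + sq p q) strictly decreases.  If k = r,
   a vertex missing no part would create H (K_r(h) plus an edge inside a part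
   contains H, since H is edge-critical); hence either the quantity decreases again
   or U is r-partite with M inside s of the parts.  As that quantity is bounded below
   once q is bounded, the second case must occur whenever q is large and the
   quantity is <= 0.
   The case s = 0 is Simonovits' theorem for edge-critical graphs, applied to F and
   J0.  When q is bounded and J0 lies outside M, all but boundedly many vertices of
   M are joined to V \ M, so J0 extends by some K_s(h) to a copy of F1 + F. *)

Set Implicit Arguments.
Unset Strict Implicit.
Unset Printing Implicit Defensive.

(** * Sums of squares of balanced partitions *)

(* The least sum of squares of k naturals of total n; the summand is the increment
   when a part of size i %/ k grows by one. *)
Definition sq (k n : nat) : nat := \sum_(i < n) (2 * (i %/ k)).+1.

Lemma sqS k n : sq k n.+1 = sq k n + (2 * (n %/ k)).+1.
Proof. by rewrite /sq big_ord_recr. Qed.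

(** Convexity: the increments of [sq k] are nondecreasing, so d further steps cost at least d times
    the first increment and, in [sq_upper], at most d times a later one. *)
Lemma sq_lower k n d : sq k n + d * (2 * (n %/ k)).+1 <= sq k (n + d).
Proof.
elim: d => [|d IH]; first by rewrite mul0n !addn0.
by rewrite addnS sqS; have := leq_div2r k (leq_addr d n); lia.
Qed.

Lemma sq_upper k n d : sq k (n + d) <= sq k n + d * (2 * ((n + d) %/ k)).+1.
Proof.
elim: d => [|d IH]; first by rewrite mul0n !addn0.
rewrite addnS sqS; have le_div := leq_div2r k (leqnSn (n + d)).
have : d * (2 * ((n + d) %/ k)).+1 <= d * (2 * ((n + d).+1 %/ k)).+1.
  by rewrite leq_mul2l; lia.
by lia.
Qed.

Lemma leq_sq k : {homo sq k : m n / m <= n}.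
Proof.
by move=> m n /subnKC<-; apply: leq_trans (sq_lower k m (n - m)); apply: leq_addr.
Qed.

(** With a = n %/ k this is the tangent line (2a+1)n - ka(a+1), written without subtraction;
    balanced parts have size a or a + 1, where the tangent is exact. *)
Lemma sq_closed k n : 0 < k ->
  sq k n + k * (n %/ k * (n %/ k).+1) = (2 * (n %/ k)).+1 * n.
Proof.
move=> k0; elim: n => [|n IH]; first by rewrite /sq big_ord0 div0n !muln0.
(* The quotient grows only when k divides n + 1, and then n + 1 = (a + 1)k makes both sides
   agree. *)
rewrite sqS divnS //; case: (boolP (k %| n.+1)) => [/divnK|_].
  rewrite divnS //; case: (k %| n.+1) => /=; move: IH; set a := n %/ k; last by lia.
  move=> IH nE; have -> : k * ((1 + a) * (1 + a).+1) = k * (a * a.+1) + 2 * (a.+1 * k).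
    by ring.
  by rewrite nE; lia.
rewrite /= add0n; lia.
Qed.

Lemma sq_le_square k n : 0 < k -> sq k n <= n * n.
Proof.
move=> k0; elim: n => [|n IH]; first by rewrite /sq big_ord0.
by rewrite sqS; have := leq_div n k; lia.
Qed.

(** Raising each of k balanced parts by T keeps them balanced; expand the squares of x + T. *)
Lemma sq_blowup k n T : 0 < k ->
  sq k (n + k * T) = sq k n + 2 * n * T + k * (T * T).
Proof.
move=> k0; have := sq_closed n k0; have := sq_closed (n + k * T) k0.
have -> : (n + k * T) %/ k = n %/ k + T by rewrite addnC mulnC divnMDl // addnC.
by set a := n %/ k; lia.
Qed.

(** Each unit enters a group whose average part is at least that of the group it leaves, so by
    convexity it adds at least as much as it removes. *)
Lemma sq_shift s p m q d : s * (q + d) <= p * m -> 0 < s -> 0 < p ->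
  sq s m + sq p (q + d) <= sq s (m + d) + sq p q.
Proof.
move=> le_qm s0 p0; have := sq_upper p q d; have := sq_lower s m d.
have : d * (2 * ((q + d) %/ p)).+1 <= d * (2 * (m %/ s)).+1.
  rewrite leq_mul2l; apply/orP; right.
  suff: (q + d) %/ p <= m %/ s by lia.
  rewrite leq_divRL //; have := leq_divM (q + d) p; nia.
by lia.
Qed.

(** After s units the quotient m %/ s has grown by one, so the remaining d - s units add strictly
    more than they remove. *)
Lemma sq_shift_lt s p m q d : s * (q + d) <= p * m -> 0 < s -> 0 < p -> s < d ->
  sq s m + sq p (q + d) < sq s (m + d) + sq p q.
Proof.
move=> le_qm s0 p0 lt_sd; have := sq_upper p q d.
have := sq_lower s m s; have := sq_lower s (m + s) (d - s).
have -> : m + s + (d - s) = m + d by lia.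
have -> : (m + s) %/ s = (m %/ s).+1 by rewrite divnDr // divnn s0 addn1.
have : d * (2 * ((q + d) %/ p)).+1 <= d * (2 * (m %/ s)).+1.
  rewrite leq_mul2l; apply/orP; right.
  suff: (q + d) %/ p <= m %/ s by lia.
  rewrite leq_divRL //; have := leq_divM (q + d) p; nia.
have -> : d * (2 * (m %/ s)).+1 = (d - s) * (2 * (m %/ s)).+1 + s * (2 * (m %/ s)).+1.
  by rewrite -mulnDl subnK // ltnW.
by nia.
Qed.

Section SumOfSquares.
Variables (I : finType) (J : {set I}) (p : I -> nat).
Hypothesis J0 : 0 < #|J|.
Let n := \sum_(i in J) p i.
Let a := n %/ #|J|.

(* Tangent line at a + 1/2: x^2 >= (2a+1)x - a(a+1) for every integer x. *)
Let tangent i : (2 * a).+1 * p i <= p i * p i + a * a.+1.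
Proof. case: (leqP (p i) a) => h; nia. Qed.

Lemma sq_sum_squares : sq #|J| n <= \sum_(i in J) p i * p i.
Proof.
have := sq_closed n J0; rewrite -/a.
have : \sum_(i in J) (2 * a).+1 * p i <= \sum_(i in J) (p i * p i + a * a.+1).
  exact: leq_sum.
by rewrite -big_distrr big_split /= sum_nat_const -/n; lia.
Qed.

(** Equality leaves no slack in any tangent inequality, and the tangent at a + 1/2 is tight only at
    a and a + 1. *)
Lemma sq_sum_squares_eq : \sum_(i in J) p i * p i <= sq #|J| n ->
  forall i, i \in J -> a <= p i <= a.+1.
Proof.
move=> le_sum i iJ; have := sq_closed n J0; rewrite -/a => eqn.
have le_rest : \sum_(j in J | j != i) (2 * a).+1 * p j <=
    \sum_(j in J | j != i) (p j * p j + a * a.+1) by apply: leq_sum.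
have e1 : \sum_(j in J) (2 * a).+1 * p j = (2 * a).+1 * n by rewrite -big_distrr.
have e2 : \sum_(j in J) (p j * p j + a * a.+1) =
    \sum_(j in J) p j * p j + #|J| * (a * a.+1) by rewrite big_split /= sum_nat_const.
rewrite (bigD1 i) //= in e1; rewrite (bigD1 i) //= in e2.
have := tangent i; nia.
Qed.

Lemma balanced_sum_squares : (forall i j, i \in J -> j \in J -> p i <= (p j).+1) ->
  \sum_(i in J) p i * p i = sq #|J| n.
Proof.
move=> bal; have [i0 i0J] : exists i, i \in J by apply/set0Pn; rewrite -card_gt0.
pose i := [arg min_(i < i0 in J) p i].
have [iJ imin] : i \in J /\ forall j, j \in J -> p i <= p j.
  by rewrite /i; case: arg_minnP.
(* All sizes lie between the minimum [p i] and [p i] + 1, with the minimum attained, so the floor of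
   the average is the minimum. *)
have aE : a = p i.
  apply/eqP; rewrite eqn_leq -ltnS ltn_divLR // leq_divRL //.
  rewrite mulnC [_ * #|J|]mulnC -!sum_nat_const leq_sum ?andbT //.
  rewrite /n (bigD1 i) //= [X in _ < X](bigD1 i) //= -addSn leq_add //.
  by apply: leq_sum => j /andP[jJ _]; exact: bal.
have := sq_closed n J0; rewrite -/a.
have : \sum_(j in J) (2 * a).+1 * p j = \sum_(j in J) (p j * p j + a * a.+1).
  apply: eq_bigr => j jJ; have := imin j jJ; have := bal j i jJ iJ; rewrite -aE.
  by move=> h1 h2; have [->|->] : p j = a \/ p j = a.+1; lia.
by rewrite -big_distrr big_split /= sum_nat_const -/n; lia.
Qed.

End SumOfSquares.

(** * Nonadjacent pairs, blow-ups and critical configurations *)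

Lemma subset_of_card (T : finType) (A : {set T}) n : n <= #|A| ->
  exists2 B : {set T}, B \subset A & #|B| = n.
Proof.
move=> le_nA; exists [set x in take n (enum A)].
  by apply/subsetP => x; rewrite inE => /mem_take; rewrite mem_enum.
rewrite cardsE; have /card_uniqP-> : uniq (take n (enum A)) by rewrite take_uniq ?enum_uniq.
by rewrite size_take -cardE; case: ltnP => //; lia.
Qed.

Section Graph.
Variables (V : finType) (G : sgraph V).
Implicit Types (B S U X M : {set V}) (u v w x y : V).

Definition nbr x : {set V} := [set y | adj G x y].

(* Ordered pairs; x counts as nonadjacent to itself. *)
Definition nonadj (A B : {set V}) : nat := \sum_(x in A) #|B :\: nbr x|.

Lemma nonadjE (A B : {set V}) : nonadj A B = \sum_(x in A) \sum_(y in B) ~~ adj G x y.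
Proof.
apply: eq_bigr => x _; rewrite -sum1_card big_mkcond [RHS]big_mkcond /=.
by apply: eq_bigr => y _; rewrite !inE andbC; case: (y \in B); case: (adj G x y).
Qed.

Lemma nonadjC (A B : {set V}) : nonadj A B = nonadj B A.
Proof.
rewrite !nonadjE exchange_big /=.
by apply: eq_bigr => x _; apply: eq_bigr => y _; rewrite adj_sym.
Qed.

Lemma nonadj_split S U B : S \subset U -> nonadj U B = nonadj S B + nonadj (U :\: S) B.
Proof. by move=> sSU; rewrite /nonadj (big_setID S) /= (setIidPr sSU). Qed.

Lemma nonadj_del S U : S \subset U ->
  nonadj U U + nonadj S S = nonadj (U :\: S) (U :\: S) + 2 * nonadj U S.
Proof.
move=> sSU; rewrite (nonadj_split _ sSU).
rewrite (nonadjC (U :\: S)) (nonadj_split _ sSU) (nonadjC U S).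
rewrite (nonadjC S U) (nonadj_split S sSU) (nonadjC S (U :\: S)); lia.
Qed.

Lemma leq_nonadj (A A' B B' : {set V}) : A \subset A' -> B \subset B' ->
  nonadj A B <= nonadj A' B'.
Proof.
move=> sA sB; rewrite (nonadj_split _ sA) (leq_trans _ (leq_addr _ _)) //.
by apply: leq_sum => x _; apply/subset_leq_card/setSD.
Qed.

(** Edges inside a part are allowed, since only subgraphs are sought; irreflexivity of [adj] makes
    the parts disjoint. *)
Definition complete_on (I : finType) (J : {set I}) (A : I -> {set V}) : Prop :=
  forall i j, i \in J -> j \in J -> i != j ->
  forall x y, x \in A i -> y \in A j -> adj G x y.

(* A blow-up of K_k in X together with an edge v w, where w lies in the part A i
   and v has h neighbours in every other part, contains each graph on at most h
   vertices that becomes k-colourable after deleting an edge. *)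
Definition crit_free X k h : Prop :=
  forall (I : finType) (J : {set I}) (A : I -> {set V}) i v w,
    #|J| = k -> (forall j, j \in J -> A j \subset X) -> complete_on J A ->
    v \in X -> i \in J -> h.+1 < #|A i| -> w \in A i -> adj G v w ->
    exists2 j, j \in J :\ i & #|A j :&: nbr v| < h.

Definition has_blowup U k T : Prop :=
  exists A : 'I_k -> {set V},
    [/\ forall j, A j \subset U, forall j, #|A j| = T & complete_on setT A].

Lemma crit_freeS X (Y : {set V}) k h h' : Y \subset X -> h <= h' ->
  crit_free X k h -> crit_free Y k h'.
Proof.
move=> sYX le_h cX I J A i v w cJ AY cA vY iJ Ai wA vw.
have [||||||||j jJ Aj] := cX I J A i v w => //; last by exists j => //; lia.
- by move=> j jJ; apply: subset_trans (AY j jJ) sYX.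
- exact: (subsetP sYX).
- by lia.
Qed.

Lemma has_blowupS U (U' : {set V}) k T : U \subset U' -> has_blowup U k T -> has_blowup U' k T.
Proof.
move=> sU [A [AU cA cpA]]; exists A; split=> // j.
exact: subset_trans sU.
Qed.

(** Take the part i with the fewest neighbours of v. If it has a neighbour w, [crit_free] yields
    another part with fewer than h neighbours, so v has fewer than h in both and misses more than T
    vertices. *)
Lemma nonnbr_blowup X k h (I : finType) (J : {set I}) (A : I -> {set V}) T v :
  crit_free X k h -> 0 < k -> #|J| = k -> (forall j, j \in J -> A j \subset X) ->
  (forall j, j \in J -> #|A j| = T) -> complete_on J A -> 2 * h + 1 < T ->
  v \in X ->
  (exists2 i, i \in J & A i :&: nbr v = set0) \/
  T < \sum_(j in J) #|A j :\: nbr v|.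
Proof.
move=> cX k0 cJ AX cA cpA lt_hT vX.
have [i0 i0J] : exists i, i \in J by apply/set0Pn; rewrite -card_gt0 cJ.
case: (boolP [exists i in J, A i :&: nbr v == set0]) => [/exists_inP[i iJ /eqP]|].
  by left; exists i.
move=> /exists_inPn nz; right.
have [i iJ imin] := arg_minnP (fun i => #|A i :&: nbr v|) i0J.
have [w] := set0Pn _ (nz i iJ); rewrite !inE => /andP[wi vw].
have [|j /setD1P[ji jJ] jh] := cX I J A i v w cJ AX cpA vX iJ _ wi vw.
  by rewrite cA //; lia.
rewrite (bigD1 i) //= (bigD1 j) ?jJ //=.
have := imin j jJ; have := cardsID (nbr v) (A i); have := cardsID (nbr v) (A j).
by rewrite !cA //; lia.
Qed.

End Graph.

(** * Embedding an edge-critical graph *)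

Section Embedding.
Variables (V : finType) (G : sgraph V) (VF : finType) (F : sgraph VF).

Definition hom_into (X : {set V}) (f : VF -> V) : Prop :=
  [/\ injective f, forall x, f x \in X & forall x y, adj F x y -> adj G (f x) (f y)].

(** Edge-criticality with chromatic number k + 1, in terms of colourings only. *)
Definition crit_at k : Prop :=
  ~~ colorable F k /\ exists2 e, e \in edges F & colorable (del_edges F [set e]) k.

Lemma colorableP (W : finType) (H : sgraph W) k :
  reflect (exists c : W -> 'I_k, forall x y, adj H x y -> c x != c y) (colorable H k).
Proof.
apply: (iffP existsP) => [[c /forallP cP]|[c cP]].
  by exists c => x y xy; have /forallP/(_ y)/implyP := cP x; apply.
exists [ffun x => c x]; apply/forallP => x; apply/forallP => y; apply/implyP.
by rewrite !ffunE; exact: cP.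
Qed.

(** The ends of the critical edge share a colour, since otherwise the colouring would be proper on F
    itself. *)
Lemma crit_atP k : crit_at k -> exists a b (c : VF -> 'I_k),
  [/\ adj F a b, c a = c b & forall x y, adj F x y -> [set x; y] != [set a; b] -> c x != c y].
Proof.
case=> nc [e eF /colorableP[c cP]].
have /cards2P[a [b [ab eE]]] : #|e| == 2 by apply: (forall_inP (edges_card2 F)).
have cP' x y : adj F x y -> [set x; y] != [set a; b] -> c x != c y.
  by move=> xy ne; apply: cP; rewrite /adj /= !inE eE ne.
exists a, b, c; split=> //; first by rewrite /adj -eE.
apply/eqP/negPn/negP => nab; case/negP: nc; apply/colorableP; exists c => x y xy.
have [exy|] := eqVneq [set x; y] [set a; b]; last exact: cP'.
have xab : (x == a) || (x == b) by rewrite -in_set2 -exy set21.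
have yab : (y == a) || (y == b) by rewrite -in_set2 -exy set22.
case/orP: xab xy => /eqP->; case/orP: yab => /eqP-> //; rewrite ?adj_irr //.
by rewrite eq_sym.
Qed.

Lemma fiberwise_injection (B : VF -> {set V}) (x0 : V) :
  (forall x, #|VF| <= #|B x|) ->
  exists2 g : VF -> V, forall x, g x \in B x &
    forall x y, B x = B y -> g x = g y -> x = y.
Proof.
move=> cB; exists (fun x => nth x0 (enum (B x)) (enum_rank x)) => [x|x y eB].
  by rewrite -mem_enum mem_nth // -cardE; apply: leq_trans (cB x).
have lt z : enum_rank x < size (enum (B z)).
  by rewrite -cardE; apply: leq_trans (cB z).
move/eqP; rewrite eB nth_uniq ?enum_uniq //; last first.
  by rewrite -cardE; apply: leq_trans (cB y).
by move=> /eqP/ord_inj/enum_rank_inj.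
Qed.

(** If v had h neighbours in every other part, F would embed in X: the critical edge a b goes to v
    w, and every other vertex goes to the part of its colour. *)
Lemma free_crit_free X k h : #|VF| <= h -> crit_at k ->
  (forall f, ~ hom_into X f) -> crit_free G X k h.
Proof.
move=> le_h critF freeF I J A i v w cJ AX cpA vX iJ Ai wi vw.
case: (boolP [exists j in J :\ i, #|A j :&: nbr G v| < h]) => [/exists_inP//|].
move=> /exists_inPn big; exfalso; move: critF; rewrite -{}cJ.
move=> /crit_atP[a [b [c [ab cab cP]]]].
(* The transposition renames the colours so that a and b get the part i of w. *)
pose d x := tperm (enum_val (c a)) i (enum_val (c x)).
have dJ x : d x \in J.
  by rewrite /d; case: tpermP => *; rewrite ?enum_valP.
have da : d a = i by rewrite /d tpermL.
have db : d b = i by rewrite -da /d cab.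
have dP x y : adj F x y -> [set x; y] != [set a; b] -> d x != d y.
  move=> xy ne; rewrite /d (inj_eq perm_inj) (inj_eq enum_val_inj); exact: cP.
(* Admissible images: v and w are reserved, which is why part i has size above h + 1, and elsewhere
   only neighbours of v are used because a is sent to v. *)
pose B j := if j == i then A i :\: [set v; w] else A j :&: nbr G v.
have cB j : j \in J -> #|VF| <= #|B j|.
  move=> jJ; rewrite /B; have [ji|ji] := eqVneq j i.
    have := cardsID [set v; w] (A i).
    have := subset_leq_card (subsetIr (A i) [set v; w]).
    by rewrite cards2; lia.
  by have := big j; rewrite !inE ji jJ -leqNgt => /(_ isT); lia.
have BA j : B j \subset A j.
  by rewrite /B; case: eqP => [->|_]; rewrite ?subsetDl ?subsetIl.
have disj j l x : j \in J -> l \in J -> x \in A j -> x \in A l -> j = l.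
  move=> jJ lJ xj xl; apply: contraTeq isT => jl.
  by have := cpA j l jJ lJ jl x x xj xl; rewrite adj_irr.
have [g gB ginj] := @fiberwise_injection (fun x => B (d x)) v (fun x => cB _ (dJ x)).
have gA x : g x \in A (d x) by apply: (subsetP (BA _)); exact: gB.
have gv x : g x != v.
  apply/eqP => gx; have := gB x; rewrite -/(g x) gx /B; case: ifP => _.
    by rewrite !inE eqxx.
  by rewrite !inE adj_irr andbF.
have gw x : g x != w.
  apply/eqP => gx; have := gB x; rewrite -/(g x) gx /B; case: eqP => dx.
    by rewrite !inE eqxx orbT.
  move=> /setIP[wd _]; case: dx; exact: (disj _ _ w).
have gI x y : g x = g y -> x = y.
  move=> gxy; have dxy : d x = d y.
    by apply: (disj _ _ (g x)) => //; rewrite gxy.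
  by apply: ginj => //; rewrite dxy.
have vAd x : d x != i -> adj G v (g x).
  by move=> dx; have := gB x; rewrite /B (negPf dx) !inE => /andP[].
have vNw : v != w by apply: contraTneq vw => ->; rewrite adj_irr.
have aNb : a != b by apply: contraTneq ab => ->; rewrite adj_irr.
pose f x := if x == a then v else if x == b then w else g x.
(* One orientation is enough, with a only as first end and b only as second; [fadj_sym] gives the
   other. *)
have fadj x y : adj F x y -> x != b -> y != a -> x != y -> [set x; y] != [set a; b] ->
    adj G (f x) (f y).
  move=> xy xb ya xny ne; have dxy := dP _ _ xy ne.
  rewrite /f (negPf ya) (negPf xb); case: (eqVneq x a) => [xa|xa].
    case: (eqVneq y b) => [yb|yb]; first by rewrite xa yb eqxx in ne.
    by apply: vAd; rewrite -da -xa eq_sym.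
  case: (eqVneq y b) => [yb|yb]; last exact: (cpA (d x) (d y)).
  by apply: (cpA (d x) i) => //; rewrite -db -yb.
apply: (freeF f); split.
- move=> x y; rewrite /f; case: (eqVneq x a) => [->|xa].
    case: (eqVneq y a) => [->//|ya].
    case: (eqVneq y b) => [->|yb] => [/eqP|/esym/eqP]; first by rewrite (negPf vNw).
    by rewrite (negPf (gv _)).
  case: (eqVneq x b) => [->|xb].
    case: (eqVneq y a) => [->/esym/eqP|ya]; first by rewrite (negPf vNw).
    by case: (eqVneq y b) => [->//|yb /esym/eqP]; rewrite (negPf (gw _)).
  case: (eqVneq y a) => [_ /eqP|ya]; first by rewrite (negPf (gv _)).
  case: (eqVneq y b) => [_ /eqP|yb]; first by rewrite (negPf (gw _)).
  exact: gI.
- move=> x; rewrite /f; case: ifP => // _.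
  by case: ifP => _; [apply: (subsetP (AX i iJ)) | apply: (subsetP (AX _ (dJ x)))].
- move=> x y xy; have [exy|ne] := eqVneq [set x; y] [set a; b].
    have xab : (x == a) || (x == b) by rewrite -in_set2 -exy set21.
    have yab : (y == a) || (y == b) by rewrite -in_set2 -exy set22.
    rewrite /f; case/orP: xab xy => /eqP->; case/orP: yab => /eqP->; rewrite ?adj_irr // => _.
      by rewrite eqxx eq_sym (negPf aNb) eqxx.
    by rewrite eqxx eq_sym (negPf aNb) eqxx adj_sym.
  have xny : x != y by apply: contraTneq xy => ->; rewrite adj_irr.
  have ba : b != a by rewrite eq_sym.
  have fadj_sym : y != b -> x != a -> adj G (f x) (f y).
    move=> yb xa; rewrite adj_sym; apply: fadj => //; first by rewrite adj_sym.
      by rewrite eq_sym.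
    by rewrite setUC.
  have [xb|xb] := eqVneq x b; first by apply: fadj_sym; rewrite -?xb 1?eq_sym // xb eq_sym.
  have [ya|ya] := eqVneq y a; last exact: fadj.
  by apply: fadj_sym; rewrite ?ya // -ya.
Qed.

End Embedding.

(** * Extending, trimming and deleting blow-ups *)

Section Blowup.
Variables (V : finType) (G : sgraph V).
Implicit Types (S U M : {set V}) (u v : V).

Record is_blowup U k T (A : 'I_k -> {set V}) : Prop := IsBlowup {
  blowup_sub : forall j, A j \subset U;
  blowup_card : forall j, #|A j| = T;
  blowup_complete : complete_on G setT A }.

Lemma blowup_disjoint U k T A : @is_blowup U k T A ->
  forall i j, i != j -> [disjoint A i & A j].
Proof.
case=> _ _ cpA i j ij; rewrite -setI_eq0; apply/eqP/setP => x; rewrite !inE.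
apply/negP => /andP[xi xj].
by have := cpA i j (in_setT _) (in_setT _) ij x x xi xj; rewrite adj_irr.
Qed.

Lemma blowup_sum U k T A (J : {set 'I_k}) (F : V -> nat) : @is_blowup U k T A ->
  \sum_(x in \bigcup_(j in J) A j) F x = \sum_(j in J) \sum_(x in A j) F x.
Proof.
move=> bA; pose B j := if j \in J then A j else set0.
have -> : \bigcup_(j in J) A j = \bigcup_j B j.
  by rewrite big_mkcond.
rewrite partition_disjoint_bigcup => [|i j ij].
  rewrite [RHS]big_mkcond /=; apply: eq_bigr => j _; rewrite /B.
  by case: ifP => // _; rewrite big_set0.
rewrite /B; case: ifP => _; last by rewrite -setI_eq0 set0I.
by case: ifP => _; [exact: (blowup_disjoint bA) | rewrite -setI_eq0 setI0].
Qed.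

Lemma blowup_card_bigcup U k T A (J : {set 'I_k}) : @is_blowup U k T A ->
  #|\bigcup_(j in J) A j| = #|J| * T.
Proof.
move=> bA; rewrite -sum1_card (blowup_sum _ _ bA) -sum_nat_const.
by apply: eq_bigr => j _; rewrite sum1_card (blowup_card bA).
Qed.

Lemma nonadj_blowup U k T A (U' : {set V}) : @is_blowup U k T A ->
  nonadj G U' (\bigcup_j A j) = \sum_(u in U') \sum_j #|A j :\: nbr G u|.
Proof.
move=> bA; rewrite nonadjE; apply: eq_bigr => u _.
have -> : \bigcup_j A j = \bigcup_(j in setT) A j.
  by apply: eq_bigl => j; rewrite inE.
rewrite (blowup_sum _ _ bA); under [LHS]eq_bigl do rewrite inE.
apply: eq_bigr => j _; rewrite -sum1_card big_mkcond [RHS]big_mkcond /=.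
by apply: eq_bigr => y _; rewrite !inE andbC; case: (y \in A j); case: (adj G u y).
Qed.

Lemma nonadj_blowup_self U k T A : @is_blowup U k T A ->
  nonadj G (\bigcup_j A j) (\bigcup_j A j) <= k * (T * T).
Proof.
move=> bA; have e : \bigcup_j A j = \bigcup_(j in setT) A j.
  by apply: eq_bigl => j; rewrite inE.
rewrite {1}/nonadj {1}e (blowup_sum _ _ bA).
have -> : k * (T * T) = \sum_(j in [set: 'I_k]) T * T.
  by rewrite sum_nat_const cardsT card_ord.
apply: leq_sum => i _; rewrite -{1}(blowup_card bA i) -sum_nat_const.
apply: leq_sum => x xi; rewrite -(blowup_card bA i); apply/subset_leq_card/subsetP => y.
rewrite !inE => /andP[nxy /bigcupP[j _ yj]].
have [<-//|ij] := eqVneq j i.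
by rewrite (blowup_complete bA (in_setT i) (in_setT j) _ xi yj) // eq_sym in nxy.
Qed.

(* Pigeonhole on the trace of the neighbourhood of u on the blow-up. *)
Lemma blowup_extend U k T A t (E : {set V}) : @is_blowup U k T A -> E \subset U ->
  (forall u j, u \in E -> t <= #|A j :&: nbr G u|) -> t * 2 ^ (k * T) < #|E| ->
  has_blowup G U k.+1 t.
Proof.
move=> bA EU tE ltE; pose S := \bigcup_(j in setT) A j.
have cS : #|S| = k * T by rewrite (blowup_card_bigcup _ bA) cardsT card_ord.
have [Z le_t] : exists Z : {set V}, t <= #|[set u in E | S :&: nbr G u == Z]|.
  apply/existsP; apply: contraTT ltE; rewrite negb_exists -leqNgt => /forallP lt.
  rewrite -sum1_card (partition_big (fun u => S :&: nbr G u) (mem (powerset S))) /=; last first.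
    by move=> u _; rewrite inE subsetIl.
  rewrite -cS -card_powerset mulnC -sum_nat_const leq_sum // => Z _.
  rewrite sum1_card; have := lt Z; rewrite -ltnNge => /ltnW; rewrite cardsE; exact: leq_trans.
have [B sB cB] := subset_of_card le_t.
have BP u : u \in B -> u \in E /\ S :&: nbr G u = Z.
  by move/(subsetP sB); rewrite inE => /andP[? /eqP].
have [t0|t0] := posnP t.
  by exists (fun _ => set0); split=> [j|j|? ? ? ? ? x y]; rewrite ?sub0set ?cards0 ?t0 ?inE.
have [b bB] : exists b, b \in B by apply/set0Pn; rewrite -card_gt0 cB.
have [bE bZ] := BP b bB.
(* All of B has the same trace as b, so sets chosen in the neighbourhood of b are joined to the
   whole of B. *)
have exC j : exists C : {set V}, C \subset A j :&: nbr G b /\ #|C| = t.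
  by have [C CA cC] := subset_of_card (tE b j bE); exists C.
have [C /all_and2[CA cC]] := fin_all_exists exC.
have CB j x u : x \in C j -> u \in B -> adj G u x.
  move=> /(subsetP (CA j)) /setIP[xj xb] uB; have [_ uZ] := BP u uB.
  have : x \in S :&: nbr G b by rewrite inE xb andbT; apply/bigcupP; exists j.
  by rewrite bZ -uZ !inE => /andP[].
exists (fun i => if unlift ord0 i is Some j then C j else B); split.
- move=> i; case: unliftP => [j _|_].
    by rewrite (subset_trans (CA j)) // (subset_trans (subsetIl _ _)) // (blowup_sub bA).
  by apply/subsetP => u /BP[/(subsetP EU)].
- by move=> i; case: unliftP.
move=> i i' _ _ ii' x y; case: unliftP ii' => [j ->|->]; case: unliftP => [j' ->|->].
- rewrite (inj_eq lift_inj) => jj' /(subsetP (CA j))/setIP[xj _].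
  by move=> /(subsetP (CA j'))/setIP[yj _]; apply: (blowup_complete bA) jj' _ _ xj yj.
- by move=> _ xj yB; rewrite adj_sym; exact: CB xj yB.
- by move=> _ xB yj; exact: CB yj xB.
- by rewrite eqxx.
Qed.

(** At least half of each part lies in M or at least half lies outside. *)
Lemma mono_blowup U M k T : has_blowup G U k (2 * T) ->
  exists2 A : 'I_k -> {set V}, is_blowup U T A &
    forall j, A j \subset M \/ [disjoint A j & M].
Proof.
case=> A [AU cA cpA].
have exB j : exists B : {set V},
    [/\ B \subset A j, #|B| = T & B \subset M \/ [disjoint B & M]].
  have := cardsID M (A j); rewrite cA => e.
  have [le_T|lt_T] := leqP T #|A j :&: M|.
    have [B sB cB] := subset_of_card le_T; exists B; split=> //.
      by apply: subset_trans sB (subsetIl _ _).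
    by left; apply: subset_trans sB (subsetIr _ _).
  have [|B sB cB] := @subset_of_card _ (A j :\: M) T; first by lia.
  exists B; split=> //; first by apply: subset_trans sB (subsetDl _ _).
  by right; move: sB; rewrite subsetD => /andP[].
have [B BP] := fin_all_exists exB.
exists B; last by move=> j; case: (BP j).
split=> [j|j|i j iT jT ij x y xi yj].
- by have [sB _ _] := BP j; apply: subset_trans sB (AU j).
- by case: (BP j).
have [sBi _ _] := BP i; have [sBj _ _] := BP j.
by apply: (cpA i j) => //; [apply: (subsetP sBi) | apply: (subsetP sBj)].
Qed.

(** With s + 1 parts inside M, a vertex v of one is joined to all of the other s, which [crit_free]
    forbids. *)
Lemma crit_free_blowup_card U k T A M s h (J : {set 'I_k}) : @is_blowup U k T A ->
  crit_free G (U :&: M) s h -> (s = 0 -> M = set0) -> h.+1 < T ->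
  (forall j, j \in J -> A j \subset M) -> #|J| <= s.
Proof.
move=> bA cM s0 ltT AM; rewrite leqNgt; apply/negP => ltJ.
have AUM j : j \in J -> A j \subset U :&: M by move=> jJ; rewrite subsetI AM // (blowup_sub bA).
have ex j : exists x, x \in A j.
  by apply/set0Pn; rewrite -card_gt0 (blowup_card bA); lia.
have [sz|s_gt0] := posnP s.
  have [j jJ] : exists j, j \in J by apply/set0Pn; rewrite -card_gt0; lia.
  by have [x /(subsetP (AM j jJ))] := ex j; rewrite s0 // inE.
have [J' sJ' cJ'] := subset_of_card (ltnW ltJ).
have [j0] : exists j, j \in J :\: J'.
  by apply/set0Pn; rewrite -card_gt0; have := cardsID J' J; rewrite (setIidPr sJ'); lia.
rewrite inE => /andP[j0J' j0J].
have [i iJ'] : exists j, j \in J' by apply/set0Pn; rewrite -card_gt0; lia.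
have [v vj0] := ex j0; have [w wi] := ex i.
have cp j x y : j \in J' -> x \in A j0 -> y \in A j -> adj G x y.
  move=> jJ' xj0 yj; apply: (blowup_complete bA (in_setT j0) (in_setT j)) xj0 yj.
  by apply: contraNneq j0J' => ->.
have [|||||j /setD1P[_ jJ']] := cM _ J' A i v w cJ' _ _ _ iJ' _ wi _.
- by move=> j /(subsetP sJ'); exact: AUM.
- by move=> j l _ _; apply: (blowup_complete bA); rewrite inE.
- exact: (subsetP (AUM j0 j0J)).
- by rewrite (blowup_card bA).
- exact: cp wi.
rewrite (setIidPl _) ?(blowup_card bA); first by lia.
by apply/subsetP => x xj; rewrite inE; exact: cp xj.
Qed.

Lemma blowup_delete U k T A M : @is_blowup U k T A ->
  (forall j, A j \subset M \/ [disjoint A j & M]) ->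
  let S := \bigcup_j A j in let J := [set j | A j \subset M] in
  [/\ S \subset U, #|S| = k * T,
      #|(U :\: S) :&: M| + #|J| * T = #|U :&: M| &
      #|(U :\: S) :\: M| + (k - #|J|) * T = #|U :\: M|].
Proof.
move=> bA mono S J.
have e : S = \bigcup_(j in setT) A j by apply: eq_bigl => j; rewrite inE.
have sSU : S \subset U by apply/bigcupsP => j _; exact: (blowup_sub bA).
have cS : #|S| = k * T by rewrite e (blowup_card_bigcup _ bA) cardsT card_ord.
have SM : S :&: M = \bigcup_(j in J) A j.
  apply/setP => x; apply/setIP/bigcupP => [[/bigcupP[j _ xj] xM]|[j]].
    exists j => //; rewrite inE; case: (mono j) => // /pred0P/(_ x) /=.
    by rewrite xj xM.
  by rewrite inE => sM xj; split; [apply/bigcupP; exists j | exact: (subsetP sM)].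
have cSM : #|S :&: M| = #|J| * T by rewrite SM (blowup_card_bigcup _ bA).
have leJ : #|J| <= k by rewrite -[k in _ <= k]card_ord max_card.
have e1 : #|U :&: M| = #|(U :\: S) :&: M| + #|S :&: M|.
  rewrite -(cardsID S (U :&: M)) addnC; congr (_ + _).
    by apply: eq_card => x; rewrite !inE; case: (x \in S).
  apply: eq_card => x; rewrite !inE; case: (boolP (x \in S)) => [xS|_]; last by rewrite ?andbF.
  by rewrite (subsetP sSU x xS) ?andbT.
have e2 : #|U :\: M| = #|(U :\: S) :\: M| + #|S :\: M|.
  rewrite -(cardsID S (U :\: M)) addnC; congr (_ + _).
    by apply: eq_card => x; rewrite !inE; case: (x \in S); case: (x \in M).
  apply: eq_card => x; rewrite !inE; case: (boolP (x \in S)) => [xS|_]; last by rewrite ?andbF.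
  by rewrite (subsetP sSU x xS) ?andbT.
have := cardsID M S; rewrite cS cSM => e3.
split=> //; first by rewrite e1 cSM.
by rewrite e2 mulnBl; lia.
Qed.

End Blowup.

(** * Deleting a complete k-partite subgraph *)

Section CoarseStep.
Variables (V : finType) (G : sgraph V) (M : {set V}) (s p h : nat).
Hypothesis p_gt0 : 0 < p.
Hypothesis M_empty : s = 0 -> M = set0.
Implicit Types (U S : {set V}).

(* The nonadjacent pairs of the extremal graph with groups U :&: M and U :\: M. *)
Definition bnd U : nat := sq s #|U :&: M| + sq p #|U :\: M|.

(** The average of s parts inside M is at least that of p parts outside, cross-multiplied so as to
    hold trivially for s = 0. *)
Definition heavy U : bool := s * #|U :\: M| <= p * #|U :&: M|.

Lemma heavy_div U : heavy U -> 0 < s -> #|U :\: M| %/ p <= #|U :&: M| %/ s.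
Proof.
rewrite /heavy => hv s0; rewrite leq_divRL //.
by have := leq_divM #|U :\: M| p; nia.
Qed.

(** By [blowup_extend], all but t 2^(kT) vertices have fewer than t neighbours in some part, and so
    miss more than T - t vertices of it. *)
Lemma nonnbr_count U k T A t : @is_blowup V G U k T A -> 0 < k ->
  ~ has_blowup G U k.+1 t ->
  T * #|U| <= nonadj G U (\bigcup_j A j) + t * #|U| + T * (t * 2 ^ (k * T)).
Proof.
move=> bA k0 noK; rewrite (nonadj_blowup _ bA).
pose E := [set u in U | [forall j, t <= #|A j :&: nbr G u|]].
have EU : E \subset U by apply/subsetP => u; rewrite inE => /andP[].
have cE : #|E| <= t * 2 ^ (k * T).
  rewrite leqNgt; apply/negP => lt; case: noK; apply: blowup_extend bA EU _ lt.
  by move=> u j; rewrite inE => /andP[_ /forallP].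
rewrite ![_ * #|U|]mulnC -!sum_nat_const.
apply: leq_trans (_ : \sum_(u in U) (\sum_j #|A j :\: nbr G u| + t) + T * #|E| <= _); last first.
  by rewrite big_split /= leq_add2l leq_mul2l cE orbT.
rewrite mulnC -sum_nat_const (big_setID E) /= (setIidPr EU).
rewrite [X in _ <= X + _](big_setID E) /= (setIidPr EU).
set sD := \sum_(i in U :\: E) _; set sD' := \sum_(i in U :\: E) _.
suff : sD <= sD' by lia.
apply: leq_sum => u; rewrite !inE => /andP[+ uU]; rewrite uU /= negb_forall.
move=> /existsP[j]; rewrite -ltnNge => lt; rewrite (bigD1 j) //=.
by have := cardsID (nbr G u) (A j); rewrite (blowup_card bA); lia.
Qed.

(* When every part lying in M has been used, the vertices of M cause no error
   term: this is what keeps the loss proportional to #|U :\: M|. *)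
Lemma nonnbr_count_full U k T A t : @is_blowup V G U k T A -> 0 < k ->
  crit_free G (U :&: M) s h -> 2 * h + 1 < T ->
  #|[set j | A j \subset M]| = s -> ~ has_blowup G U k.+1 t ->
  T * #|U| <= nonadj G U (\bigcup_j A j) + t * #|U :\: M| + T * (t * 2 ^ (k * T)).
Proof.
move=> bA k0 cM ltT cJ noK.
pose E := [set u in U | [forall j, t <= #|A j :&: nbr G u|]].
have EU : E \subset U by apply/subsetP => u; rewrite inE => /andP[].
have cE : #|E| <= t * 2 ^ (k * T).
  rewrite leqNgt; apply/negP => lt; case: noK; apply: blowup_extend bA EU _ lt.
  by move=> u j; rewrite inE => /andP[_ /forallP].
have inM u : u \in U :&: M -> T <= \sum_j #|A j :\: nbr G u|.
  move=> uM; have s0 : 0 < s.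
    by rewrite lt0n; apply: contraTneq uM => /M_empty ->; rewrite setI0 inE.
  have AM j : j \in [set j | A j \subset M] -> A j \subset U :&: M.
    by rewrite inE subsetI (blowup_sub bA) => ->.
  have cpJ : complete_on G [set j | A j \subset M] A.
    by move=> i j _ _; apply: (blowup_complete bA); rewrite inE.
  have [[i _ Ai]|lt] := nonnbr_blowup cM s0 cJ AM (fun j _ => blowup_card bA j) cpJ ltT uM.
    rewrite (bigD1 i) //=; have := cardsID (nbr G u) (A i).
    by rewrite Ai cards0 (blowup_card bA); lia.
  apply: leq_trans (ltnW lt) _; rewrite [X in _ <= X](bigID (mem [set j | A j \subset M])) /=.
  exact: leq_addr.
have outM u : u \in (U :\: M) :\: E -> T <= \sum_j #|A j :\: nbr G u| + t.
  rewrite !inE => /and3P[+ _ uU]; rewrite uU /= negb_forall.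
  move=> /existsP[j]; rewrite -ltnNge => lt; rewrite (bigD1 j) //=.
  by have := cardsID (nbr G u) (A j); rewrite (blowup_card bA); lia.
rewrite (nonadj_blowup _ bA) -(cardsID M U) mulnDr (big_setID M) /= -!addnA.
apply: leq_add; first by rewrite mulnC -sum_nat_const; exact: leq_sum.
rewrite addnA.
have h1 : T * #|(U :\: M) :&: E| <= T * (t * 2 ^ (k * T)).
  by rewrite leq_mul2l (leq_trans (subset_leq_card (subsetIr _ _)) cE) orbT.
rewrite -(cardsID E (U :\: M)) mulnDr [X in _ <= X + _ + _](big_setID E) /=.
have h2 : T * #|(U :\: M) :\: E| <=
    \sum_(u in (U :\: M) :\: E) (\sum_j #|A j :\: nbr G u| + t).
  by rewrite mulnC -sum_nat_const; exact: leq_sum.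
rewrite big_split /= sum_nat_const in h2.
move: h1 h2; rewrite mulnDr; lia.
Qed.

(** As k < s + p, the k deleted parts leave at least one average part unaccounted for; the resulting
    slack, linear in [#|U :\: M|], absorbs every error term and the gain L. *)
Lemma chunk_step U k T t L : crit_free G (U :&: M) s h -> heavy U ->
  0 < k -> k < s + p -> 2 * (s + p) * t <= T -> 2 * h + 1 < T ->
  p * (k * T + L + k * (T * T) + 2 * (T * (t * 2 ^ (k * T))) + 2 * T) <= #|U :\: M| ->
  has_blowup G U k (2 * T) -> ~ has_blowup G U k.+1 t ->
  exists S, [/\ S \subset U, 0 < #|S|, #|S| <= k * T &
    bnd U + nonadj G (U :\: S) (U :\: S) + L <= nonadj G U U + bnd (U :\: S)].
Proof.
move=> cM hv k0 ltk le_tT lt_hT le_q /(mono_blowup M)[A bA mono] noK.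
have [sSU cS] := blowup_delete bA mono.
set S := \bigcup_j A j in sSU cS *; set J := [set j | A j \subset M] => em eq.
have lex : #|J| <= s.
  apply: (crit_free_blowup_card bA cM M_empty); first by lia.
  by move=> j; rewrite inE.
have lexk : #|J| <= k by rewrite -[k in _ <= k]card_ord max_card.
have NS := nonadj_blowup_self bA; rewrite -/S in NS.
have dS := nonadj_del G sSU.
have c1 := nonnbr_count bA k0 noK; rewrite -/S in c1.
have c2 := nonnbr_count_full bA k0 cM lt_hT _ noK; rewrite -/S -/J in c2.
have eU := cardsID M U.
have u1 := sq_upper s #|(U :\: S) :&: M| (#|J| * T); rewrite em in u1.
have u2 := sq_upper p #|(U :\: S) :\: M| ((k - #|J|) * T); rewrite eq in u2.
have le_ba := heavy_div hv.
exists S; split=> //; first by rewrite cS muln_gt0 k0; lia.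
  by rewrite cS.
rewrite /bnd.
set a := _ %/ s in u1 le_ba; set b := _ %/ p in u2 le_ba.
have lt_q : #|U :\: M| < p * b.+1 by rewrite mulnC -ltn_divLR.
have ge_q : p * b <= #|U :\: M| by rewrite mulnC leq_divM.
have ge_m : s * a <= #|U :&: M| by rewrite mulnC leq_divM.
have lt_m : 0 < s -> #|U :&: M| < s * a.+1 by move=> s_gt0; rewrite mulnC -ltn_divLR.
clearbody a b.
(* The size of [#|U :\: M|] makes b exceed all the constants. *)
have le_K : k * T + L + k * (T * T) + 2 * (T * (t * 2 ^ (k * T))) + T <= T * b.
  move: le_q lt_q; set K := _ + _ + _ + _; set K' := _ + _ + _ + _ => le_q lt_q.
  have lt_Kb : K < b.+1 by rewrite -(ltn_pmul2l p_gt0); apply: leq_ltn_trans le_q lt_q.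
  have : K <= T * b by apply: (@leq_trans b); [lia | apply: leq_pmull; lia].
  by rewrite /K /K'; lia.
set C := T * (t * 2 ^ (k * T)) in c1 c2 le_K *.
set x := #|J| in em eq u1 u2 lex lexk c2.
set N := nonadj G U U in dS *; set N' := nonadj G (U :\: S) _ in dS *.
set NU := nonadj G U S in c1 c2 dS *; set NSS := nonadj G S S in NS dS.
set m := #|U :&: M| in eU u1 ge_m lt_m *; set q := #|U :\: M| in eU u2 lt_q ge_q c2 *.
set m' := sq s #|_ :&: M| in u1 *; set q' := sq p #|_ :\: M| in u2 *.
(* Deleting S lowers [bnd] by at most 2T(xa + (k - x)b) + kT, and the nonadjacent pairs by at least
   2 NU - k T^2. *)
suff main : 2 * T * (x * a + (k - x) * b) + (k * T + L + k * (T * T)) <= 2 * NU.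
  have : x * T * (2 * a).+1 + (k - x) * T * (2 * b).+1 =
     2 * T * (x * a + (k - x) * b) + (x + (k - x)) * T by ring.
  by rewrite subnKC //; lia.
(* If x = s, fewer than p parts lie outside M: the slack is b, and the error from [c2] is only t q.
   If x < s, the slack is a, which pays for the error t (m + q). *)
have [xs|lt_xs] := eqVneq x s.
  have := c2 xs; rewrite -eU.
  have sum_le : x * a + (k - x) * b + b <= m + q.
    have : x * a <= m by rewrite xs.
    have : (k - x).+1 * b <= q by apply: leq_trans ge_q; rewrite leq_mul2r; lia.
    by rewrite mulSn; lia.
  have le_t : 2 * (t * q) <= T * b + T.
    apply: leq_trans (_ : 2 * (t * (p * b.+1)) <= _); first by rewrite !leq_mul2l /= ltnW ?orbT.
    have -> : T * b + T = T * b.+1 by rewrite mulnS addnC.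
    apply: leq_trans (leq_mul le_tT (leqnn b.+1)).
    have -> : 2 * (s + p) * t * b.+1 = 2 * (t * (p * b.+1)) + 2 * (t * (s * b.+1)) by ring.
    exact: leq_addr.
  have : 2 * T * (x * a + (k - x) * b + b) <= 2 * T * (m + q).
    by rewrite leq_mul2l sum_le orbT.
  by clear -le_K le_t; lia.
have {}lt_xs : x < s by rewrite ltn_neqAle lt_xs.
have s_gt0 : 0 < s by lia.
have {}le_ba := le_ba s_gt0.
have {}lt_m := lt_m s_gt0.
have sum_le : x * a + (k - x) * b + a <= m + q.
  have [le_p|lt_p] := leqP (k - x) p.
    have : x.+1 * a <= m by apply: leq_trans ge_m; rewrite leq_mul2r lt_xs orbT.
    have : (k - x) * b <= q by apply: leq_trans ge_q; rewrite leq_mul2r le_p orbT.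
    by rewrite mulSn; lia.
  (* With more than p parts outside M, those beyond p are charged to M, using b <= a. *)
  have -> : k - x = p + (k - x - p) by lia.
  have : (k - x - p) * b <= (k - x - p) * a by rewrite leq_mul2l le_ba orbT.
  have : (x + (k - x - p)).+1 * a <= m by apply: leq_trans ge_m; rewrite leq_mul2r; lia.
  by rewrite mulSn !mulnDl; lia.
have le_n : m + q <= (s + p) * a.+1.
  have : p * b.+1 <= p * a.+1 by rewrite leq_mul2l; lia.
  by rewrite mulnDl; lia.
have le_t : 2 * (t * #|U|) <= T * a + T.
  rewrite -eU; apply: leq_trans (_ : 2 * (t * ((s + p) * a.+1)) <= _).
    by rewrite !leq_mul2l /= le_n orbT.
  have -> : T * a + T = T * a.+1 by rewrite mulnS addnC.
  have -> : 2 * (t * ((s + p) * a.+1)) = 2 * (s + p) * t * a.+1 by ring.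
  by rewrite leq_mul2r le_tT orbT.
have : 2 * T * (x * a + (k - x) * b + a) <= 2 * T * (m + q).
  by rewrite leq_mul2l sum_le orbT.
have : T * b <= T * a by rewrite leq_mul2l le_ba orbT.
by move: c1 le_t; rewrite -eU; clear -le_K; lia.
Qed.

End CoarseStep.

Lemma has_blowup_dec (V : finType) (G : sgraph V) U k T :
  has_blowup G U k T \/ ~ has_blowup G U k T.
Proof.
case: (boolP [exists A : {ffun 'I_k -> {set V}}, [&& [forall j, A j \subset U],
    [forall j, #|A j| == T] & [forall i, forall j, (i != j) ==>
      [forall x in A i, forall y in A j, adj G x y]]]]) => [/existsP[A]|no].
  move=> /and3P[/forallP AU /forallP cA /forallP cpA]; left; exists A; split=> //.
    by move=> j; apply/eqP.
  move=> i j _ _ ij x y xi yj; have /forallP/(_ j)/implyP/(_ ij) := cpA i.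
  by move=> /forall_inP/(_ x xi)/forall_inP/(_ y yj).
right=> -[A [AU cA cpA]]; case/existsP: no; exists [ffun j => A j].
apply/and3P; split; apply/forallP => i; rewrite ?ffunE ?cA //.
apply/forallP => j; apply/implyP => ij; apply/forall_inP => x xi.
apply/forall_inP => y yj; move: xi yj; rewrite !ffunE; apply: cpA => //.
Qed.

(** Induction on k: if K_k(2T) is present, [chunk_step] applies, and otherwise t is replaced by 2T
    at the level below. The size bound c precedes L, so that L may be a multiple of c. *)
Lemma coarse_step s p h t k : 0 < p -> k < s + p -> exists c, forall L, exists Q,
  forall (V : finType) (G : sgraph V) (M U : {set V}),
  (s = 0 -> M = set0) -> crit_free G (U :&: M) s h -> heavy M s p U ->
  Q <= #|U :\: M| -> ~ has_blowup G U k.+1 t ->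
  exists S : {set V}, [/\ S \subset U, 0 < #|S|, #|S| <= c &
    bnd M s p U + nonadj G (U :\: S) (U :\: S) + L <=
    nonadj G U U + bnd M s p (U :\: S)].
Proof.
move=> p0; elim: k t => [|k IH] t ltk.
  exists 0 => L; exists t => V G M U _ _ _ leQ; case.
  have [B BU cB] := subset_of_card leQ.
  exists (fun _ => B); split=> // [j|i j]; last by rewrite !ord1 eqxx.
  by apply: subset_trans BU (subsetDl _ _).
pose T := 2 * (s + p) * t + 2 * h + 2.
have [c IHc] := IH (2 * T) (ltnW ltk).
exists (c + k.+1 * T) => L; have [Q IHQ] := IHc L.
exists (Q + p * (k.+1 * T + L + k.+1 * (T * T) + 2 * (T * (t * 2 ^ (k.+1 * T))) + 2 * T)).
move=> V G M U M0 cM hv leQ noK.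
have [K|noK'] := has_blowup_dec G U k.+1 (2 * T).
  have [|||S [SU S0 cS dS]] := chunk_step p0 M0 (L := L) cM hv (ltn0Sn k) ltk _ _ _ K noK.
  - by rewrite /T; lia.
  - by rewrite /T; lia.
  - by apply: leq_trans leQ; exact: leq_addl.
  by exists S; split=> //; apply: leq_trans cS (leq_addl _ _).
have [|S [SU S0 cS dS]] := IHQ V G M U M0 cM hv _ noK'.
  by apply: leq_trans leQ; exact: leq_addr.
by exists S; split=> //; apply: leq_trans cS (leq_addr _ _).
Qed.

Lemma crit_free0 (V : finType) (G : sgraph V) X h : crit_free G X 0 h.
Proof. by move=> I J A i v w /eqP; rewrite cards_eq0 => /eqP->; rewrite inE. Qed.

(** A weak Erdos-Stone theorem: the surplus over the Turan value beats any linear function. With M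
    empty, each deletion of at most c vertices gains (L + 1)c; one unit of slope absorbs the
    constant C. *)
Lemma erdos_stone r t L : 0 < r -> exists N0,
  forall (V : finType) (G : sgraph V) (U : {set V}),
  N0 <= #|U| -> ~ has_blowup G U r t -> sq r #|U| + L * #|U| <= nonadj G U U.
Proof.
move=> r0; have ltr : r.-1 < 0 + r by lia.
have [c stepc] := coarse_step 0 t r0 ltr.
have [Q step] := stepc (L.+1 * c); rewrite (prednK r0) in step.
pose C := sq r Q + L.+1 * Q.
have main n : forall (V : finType) (G : sgraph V) (U : {set V}), #|U| = n ->
    ~ has_blowup G U r t -> sq r n + L.+1 * n <= nonadj G U U + C.
  elim/ltn_ind: n => n IH V G U cU noK.
  have [leQ|ltQ] := leqP Q n; last first.
    have := leq_sq r (ltnW ltQ); have : L.+1 * n <= L.+1 * Q by rewrite leq_mul2l ltnW ?orbT.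
    by rewrite /C; lia.
  have [||||S [SU S0 cS dS]] := step V G set0 U _ _ _ _ noK => //.
  - exact: crit_free0.
  - by rewrite setD0 cU.
  have bndE (W : {set V}) : bnd set0 0 r W = sq r #|W|.
    by rewrite /bnd setI0 cards0 setD0 /sq big_ord0.
  rewrite !bndE cU in dS.
  have cD : #|U :\: S| + #|S| = n.
    by have := cardsID S U; rewrite (setIidPr SU) cU addnC.
  have noK' : ~ has_blowup G (U :\: S) r t.
    by move=> K; apply: noK; apply: has_blowupS K; exact: subsetDl.
  have lt_n : #|U :\: S| < n by lia.
  have := IH _ lt_n V G (U :\: S) erefl noK'.
  have : L.+1 * #|S| <= L.+1 * c by rewrite leq_mul2l cS orbT.
  have : L.+1 * n = L.+1 * #|U :\: S| + L.+1 * #|S| by rewrite -mulnDr cD.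
  by lia.
exists C => V G U leC noK; have := main _ V G U erefl noK.
by rewrite mulSn; lia.
Qed.

(** * Complete r-partite subgraphs *)

Definition structured (V : finType) (G : sgraph V) (M : {set V}) s r (U : {set V}) : Prop :=
  exists (c : V -> 'I_r) (I : {set 'I_r}), [/\ #|I| = s,
    forall x y, x \in U -> y \in U -> c x = c y -> ~~ adj G x y &
    forall x, x \in U :&: M -> c x \in I].

Section FineStep.
Variables (V : finType) (G : sgraph V) (M : {set V}) (s p h : nat).
Hypothesis p_gt0 : 0 < p.
Hypothesis M_empty : s = 0 -> M = set0.
Variables (U : {set V}) (T : nat) (A : 'I_(s + p) -> {set V}).
Hypothesis critU : crit_free G U (s + p) h.
Hypothesis critM : crit_free G (U :&: M) s h.
Hypothesis bA : is_blowup G U T A.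
Hypothesis monoA : forall j, A j \subset M \/ [disjoint A j & M].
Hypothesis lt_hT : 2 * h + 1 < T.
Hypothesis lt_sT : s < T.
Let S := \bigcup_j A j.
Let J := [set j | A j \subset M].

Let nonnbr_cases u : u \in U ->
  (exists i, A i :&: nbr G u = set0) \/ T < \sum_j #|A j :\: nbr G u|.
Proof.
move=> uU; have r0 : 0 < s + p by lia.
have [||||[i _ Ai]|lt] := nonnbr_blowup (J := setT) (A := A) critU r0 _ _ _ _ lt_hT uU.
- by rewrite cardsT card_ord.
- by move=> j _; exact: (blowup_sub bA).
- by move=> j _; exact: (blowup_card bA).
- exact: (blowup_complete bA).
- by left; exists i.
by right; move: lt; under eq_bigl do rewrite inE.
Qed.

Let nonnbr_ge u : u \in U -> T <= \sum_j #|A j :\: nbr G u|.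
Proof.
case/nonnbr_cases => [[i Ai]|/ltnW//]; rewrite (bigD1 i) //=.
by have := cardsID (nbr G u) (A i); rewrite Ai cards0 (blowup_card bA); lia.
Qed.

Let nbr_other u i j : u \in U -> \sum_j #|A j :\: nbr G u| <= T ->
  A i :&: nbr G u = set0 -> j != i -> A j \subset nbr G u.
Proof.
move=> uU le_T Ai ji; rewrite -setD_eq0 -cards_eq0; move: le_T.
rewrite (bigD1 i) //= (bigD1 j) //=.
by have := cardsID (nbr G u) (A i); rewrite Ai cards0 (blowup_card bA); lia.
Qed.

(** A vertex with only T nonneighbours in S misses exactly one part and is joined to all others; the
    missed part is its colour. *)
Lemma tight_structured : #|J| = s ->
  (forall u, u \in U -> \sum_j #|A j :\: nbr G u| <= T) -> structured G M s (s + p) U.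
Proof.
move=> cJ tight; have r0 : 0 < s + p by lia.
(* The default colour is never reached on U, by [cP]. *)
pose c u := odflt (Ordinal r0) [pick i | A i :&: nbr G u == set0].
have cP u : u \in U -> A (c u) :&: nbr G u = set0.
  move=> uU; rewrite /c; case: pickP => [i /eqP//|no].
  have [[i Ai]|] := nonnbr_cases uU; first by have := no i; rewrite Ai eqxx.
  by rewrite ltnNge tight.
have cN u j : u \in U -> j != c u -> A j \subset nbr G u.
  by move=> uU; apply: nbr_other => //; [exact: tight | exact: cP].
exists c, J; split=> // [x y xU yU cxy|u uUM].
  apply/negP => xy.
  (* Adding y to its own part keeps a complete r-partite graph, now with an edge from x into that
     part, while x is joined to all other parts: [crit_free] is violated. *)
  pose A' j := if j == c x then y |: A j else A j.
  have [||||||||j /setD1P[ji _]] := critU (J := setT) (A := A') (i := c x) (v := x) (w := y).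
  - by rewrite cardsT card_ord.
  - move=> j _; rewrite /A'; case: ifP => _; last exact: (blowup_sub bA).
    by rewrite subUset sub1set yU (blowup_sub bA).
  - have cp j u : j != c x -> u \in A j -> adj G y u.
      by move=> ji uj; have := subsetP (cN y j yU _) u uj; rewrite -cxy inE => ->.
    move=> i j _ _ ij u v; rewrite /A'.
    case: eqP => [ei|_]; case: eqP => [ej|_]; first by rewrite ei ej eqxx in ij.
    + rewrite in_setU1 => /orP[/eqP->|ui] vj; first by apply: cp vj; rewrite -ei eq_sym.
      exact: (blowup_complete bA (in_setT i) (in_setT j)) ui vj.
    + rewrite in_setU1 => ui /orP[/eqP->|vj]; first by rewrite adj_sym; apply: cp ui; rewrite -ej.
      exact: (blowup_complete bA (in_setT i) (in_setT j)) ui vj.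
    exact: (blowup_complete bA (in_setT i) (in_setT j)).
  - exact: xU.
  - by rewrite inE.
  - rewrite /A' eqxx; apply: (@leq_trans #|A (c x)|); first by rewrite (blowup_card bA); lia.
    by apply/subset_leq_card/subsetUr.
  - by rewrite /A' eqxx setU11.
  - exact: xy.
  rewrite /A' (negPf ji) (setIidPl (cN x j xU ji)) (blowup_card bA); lia.
have s0 : 0 < s.
  by rewrite lt0n; apply: contraTneq uUM => /M_empty ->; rewrite setI0 inE.
have uU : u \in U by case/setIP: uUM.
have AM j : j \in J -> A j \subset U :&: M.
  by rewrite inE subsetI (blowup_sub bA) => ->.
have cpJ : complete_on G J A.
  by move=> i j _ _; apply: (blowup_complete bA); rewrite inE.
have [[i iJ Ai]|lt] := nonnbr_blowup critM s0 cJ AM (fun j _ => blowup_card bA j) cpJ lt_hT uUM.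
  suff -> : c u = i by [].
  apply/eqP; rewrite eq_sym; apply: contraT => ic.
  have := cN u i uU ic; move/setIidPl; rewrite Ai => A0.
  by have := blowup_card bA i; rewrite -A0 cards0; lia.
have := tight u uU; rewrite (bigID (mem J)) /= => le_T.
by have := leq_trans lt (leq_trans (leq_addr _ _) le_T); rewrite ltnn.
Qed.

(** Every vertex misses at least T vertices of S, which matches the drop of [bnd] exactly when s
    parts lie in M; then only tight vertices prevent a strict gain. With fewer parts in M, the gain
    comes from [sq_shift_lt]. *)
Lemma fine_step : heavy M s p U -> p * T <= #|U :\: M| ->
  structured G M s (s + p) U \/
  exists S : {set V}, [/\ S \subset U, 0 < #|S|, #|S| <= (s + p) * T,
    bnd M s p U + nonadj G (U :\: S) (U :\: S) < nonadj G U U + bnd M s p (U :\: S) &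
    heavy M s p (U :\: S)].
Proof.
move=> hv le_q; have [sSU cS] := blowup_delete bA monoA.
rewrite -/S -/J in sSU cS * => em eq.
have lex : #|J| <= s.
  apply: (crit_free_blowup_card bA critM M_empty); first by lia.
  by move=> j; rewrite inE.
have NS := nonadj_blowup_self bA; rewrite -/S in NS.
have dS := nonadj_del G sSU.
have NU : nonadj G U S = \sum_(u in U) \sum_j #|A j :\: nbr G u| by apply: nonadj_blowup bA.
have geNU : T * #|U| <= nonadj G U S.
  by rewrite NU mulnC -sum_nat_const; apply: leq_sum => u; exact: nonnbr_ge.
have eU := cardsID M U.
(* At most s of the s + p equal parts are taken from M, so the inequality between the averages
   survives. *)
have hv' : heavy M s p (U :\: S).
  move: hv; rewrite /heavy -em -eq !mulnDr => hv.
  have : p * (#|J| * T) <= s * ((s + p - #|J|) * T).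
    rewrite !mulnA leq_mul2r; apply/orP; right; nia.
  by lia.
have S0 : 0 < #|S| by rewrite cS muln_gt0; lia.
have le_m : s * T <= #|U :&: M|.
  rewrite -(leq_pmul2l p_gt0); apply: leq_trans hv.
  by rewrite mulnCA leq_mul2l le_q orbT.
have sblow_p : sq p #|U :\: M| = sq p (#|U :\: M| - p * T)
   + 2 * (#|U :\: M| - p * T) * T + p * (T * T).
  by rewrite -sq_blowup // subnK.
have sblow_s : sq s #|U :&: M| = sq s (#|U :&: M| - s * T)
   + 2 * (#|U :&: M| - s * T) * T + s * (T * T).
  have [sz|s0] := posnP s; last by rewrite -sq_blowup // subnK.
  by rewrite M_empty // setI0 cards0 sz mul0n subn0; clear; lia.
have e1 : T * #|U| = T * (#|U :&: M| - s * T) + T * (#|U :\: M| - p * T) + (s + p) * (T * T).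
  rewrite -eU -{1}(subnK le_m) -{1}(subnK le_q); ring.
have [xs|] := eqVneq #|J| s.
  case: (boolP [exists u in U, T < \sum_j #|A j :\: nbr G u|]) => [/exists_inP[u uU lt]|no].
    right; exists S; split=> //; first by rewrite cS.
    have gtNU : T * #|U| < nonadj G U S.
      rewrite NU mulnC -sum_nat_const (bigD1 u) //= [X in _ < X](bigD1 u) //= -addSn.
      by apply: leq_add lt _; apply: leq_sum => w /andP[wU _]; exact: nonnbr_ge.
    have -> : bnd M s p (U :\: S) = sq s (#|U :&: M| - s * T) + sq p (#|U :\: M| - p * T).
      by rewrite /bnd -em -eq xs addnK addKn addnK.
    rewrite /bnd sblow_s sblow_p; clear -NS dS gtNU e1; lia.
  left; apply: tight_structured => // u uU; rewrite leqNgt; apply: contra no => lt.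
  by apply/exists_inP; exists u.
move=> nxs; have lt_xs : #|J| < s by rewrite ltn_neqAle nxs.
right; exists S; split=> //; first by rewrite cS.
(* Compared with deleting s parts from M and p outside, d more vertices remain in M and d fewer
   outside. *)
pose d := (s - #|J|) * T.
have lt_sd : s < d by apply: leq_trans lt_sT _; apply: leq_pmull; lia.
have em' : #|(U :\: S) :&: M| = (#|U :&: M| - s * T) + d.
  have : s * T = #|J| * T + d by rewrite -mulnDl subnKC.
  by lia.
have eq' : #|U :\: M| - p * T = #|(U :\: S) :\: M| + d.
  have : (s + p - #|J|) * T = p * T + d by rewrite -mulnDl; congr (_ * _); lia.
  by lia.
have := @sq_shift_lt s p (#|U :&: M| - s * T) #|(U :\: S) :\: M| d _ _ p_gt0 lt_sd.
rewrite -em' -eq' => lt_sq.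
have {lt_sq} : sq s (#|U :&: M| - s * T) + sq p (#|U :\: M| - p * T) < bnd M s p (U :\: S).
  apply: lt_sq; last by lia.
  rewrite !mulnBr; move: hv; rewrite /heavy.
  have -> : s * (p * T) = p * (s * T) by rewrite mulnCA.
  by lia.
rewrite {2}/bnd sblow_s sblow_p; clear -NS dS geNU e1; lia.
Qed.

End FineStep.

(** * Progressive induction *)

Section Partite.
Variables (V : finType) (G : sgraph V) (r : nat) (c : V -> 'I_r).
Implicit Types (U : {set V}) (I : {set 'I_r}).

Definition class U i : {set V} := [set x in U | c x == i].

Lemma card_classes U I : \sum_(i in I) #|class U i| = #|[set x in U | c x \in I]|.
Proof.
rewrite -sum1_card (partition_big c (mem I)) /= => [|x]; last by rewrite inE => /andP[].
apply: eq_bigr => i iI; rewrite -sum1_card; apply: eq_bigl => x; rewrite !inE.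
by have [->|] := eqVneq (c x) i; rewrite ?iI ?andbT ?andbF.
Qed.

Lemma sum_class_squares U :
  \sum_i #|class U i| * #|class U i| = \sum_(x in U) \sum_(y in U) (c x == c y).
Proof.
rewrite [RHS](partition_big c predT) //=; apply: eq_bigr => i _.
rewrite -sum_nat_const; have -> : \sum_(x in U | c x == i) \sum_(y in U) (c x == c y) =
    \sum_(x in class U i) \sum_(y in U) (c x == c y).
  by apply: eq_bigl => x; rewrite inE.
apply: eq_bigr => x; rewrite inE => /andP[_ /eqP->].
rewrite -sum1_card big_mkcond [RHS]big_mkcond /=; apply: eq_bigr => y _.
by rewrite inE eq_sym; case: (y \in U); case: (i == c y).
Qed.

Lemma class_squares_le U : (forall x y, x \in U -> y \in U -> c x = c y -> ~~ adj G x y) ->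
  \sum_i #|class U i| * #|class U i| <= nonadj G U U.
Proof.
move=> cP; rewrite sum_class_squares nonadjE; apply: leq_sum => x xU.
by apply: leq_sum => y yU; case: eqP => // /(cP x y xU yU) ->.
Qed.

End Partite.

(** Here d counts the vertices outside M with colour in I; by [heavy], moving them to the first
    group cannot lower the bound. *)
Lemma structured_sq (V : finType) (G : sgraph V) (M U : {set V}) s p r
    (c : V -> 'I_r) (I : {set 'I_r}) : 0 < p -> heavy M s p U -> r = s + p -> #|I| = s ->
  (s = 0 -> M = set0) ->
  (forall x y, x \in U -> y \in U -> c x = c y -> ~~ adj G x y) ->
  (forall x, x \in U :&: M -> c x \in I) ->
  exists d, [/\ \sum_(i in I) #|class c U i| = #|U :&: M| + d,
    \sum_(i in ~: I) #|class c U i| + d = #|U :\: M| &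
    bnd M s p U <= sq s (#|U :&: M| + d) + sq p (#|U :\: M| - d)].
Proof.
move=> p0 hv rE cI M0 cP cM; pose d := #|[set x in U | c x \in I] :\: M|.
have e1 : \sum_(i in I) #|class c U i| = #|U :&: M| + d.
  rewrite card_classes -(cardsID M); congr (_ + _); apply: eq_card => x.
  have := cM x; rewrite !inE.
  by case: (x \in U); case: (x \in M); case: (c x \in I) => // /(_ isT).
have e2 : \sum_(i in ~: I) #|class c U i| + d = #|U :\: M|.
  rewrite card_classes -(cardsID [set x | c x \in I] (U :\: M)) addnC.
  congr (_ + _); apply: eq_card => x; rewrite !inE.
    by case: (x \in U); case: (x \in M); case: (c x \in I).
  have := cM x; rewrite !inE.
  by case: (x \in U); case: (x \in M); case: (c x \in I) => // /(_ isT).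
exists d; split=> //; rewrite /bnd.
have [s0|s0] := posnP s; last first.
  have -> : #|U :\: M| = (#|U :\: M| - d) + d by lia.
  by rewrite addnK; apply: sq_shift => //; rewrite subnK; [exact: hv | lia].
have : d = 0.
  apply/eqP; rewrite cards_eq0; apply/eqP/setP => x; rewrite !inE.
  have -> : I = set0 by apply/eqP; rewrite -cards_eq0 cI s0.
  by rewrite inE !andbF.
by move=> ->; rewrite addn0 subn0.
Qed.

Lemma structured_squares (V : finType) (U : {set V}) s p r
    (c : V -> 'I_r) (I : {set 'I_r}) : 0 < p -> r = s + p -> #|I| = s ->
  sq s (\sum_(i in I) #|class c U i|) + sq p (\sum_(i in ~: I) #|class c U i|) <=
  \sum_i #|class c U i| * #|class c U i|.
Proof.
move=> p0 rE cI; have cIC : #|~: I| = p by rewrite cardsCs setCK card_ord cI rE addKn.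
rewrite [X in _ <= X](bigID (mem I)) /= leq_add //; last first.
  under [X in _ <= X]eq_bigl do rewrite -in_setC.
  by rewrite -{1}cIC; apply: sq_sum_squares; rewrite cIC.
have [s0|s0] := posnP s; last by rewrite -{1}cI; apply: sq_sum_squares; rewrite cI.
have -> : I = set0 by apply/eqP; rewrite -cards_eq0 cI s0.
by rewrite !big_set0 /sq big_ord0.
Qed.

Lemma structured_bnd (V : finType) (G : sgraph V) (M U : {set V}) s p : 0 < p ->
  heavy M s p U -> (s = 0 -> M = set0) -> structured G M s (s + p) U ->
  bnd M s p U <= nonadj G U U.
Proof.
move=> p0 hv M0 [c [I [cI cP cM]]].
have [d [e1 e2 le_bnd]] := structured_sq p0 hv erefl cI M0 cP cM.
apply: leq_trans le_bnd _; apply: leq_trans (class_squares_le cP).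
have := structured_squares U c p0 erefl cI.
by rewrite e1 -e2 addnK.
Qed.

Lemma sq_multiple k b : 0 < k -> sq k (k * b) = k * (b * b).
Proof. by move=> k0; have := sq_blowup 0 b k0; rewrite {2}/sq big_ord0 => ->; lia. Qed.

(** When the two group averages differ by a bounded amount, the two-group bound is within a linear
    term of the balanced one; [erdos_stone] excludes so small a surplus. *)
Lemma bnd_near_balanced (V : finType) (M U : {set V}) s p c : 0 < p -> 0 < s ->
  heavy M s p U -> p * #|U :&: M| <= s * #|U :\: M| + p * c ->
  bnd M s p U <= sq (s + p) #|U| + (s + p + c) * (2 * #|U| + 1).
Proof.
move=> p0 s0; rewrite /heavy /bnd -(cardsID M U).
set m := #|U :&: M|; set q := #|U :\: M| => hv near.
pose b := q %/ p; have ge_q : p * b <= q by rewrite mulnC leq_divM.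
have lt_q : q < p * b.+1 by rewrite mulnC -ltn_divLR.
have ge_m : s * b <= m.
  by rewrite -(leq_pmul2l p0) mulnCA; apply: leq_trans hv; rewrite leq_mul2l ge_q orbT.
have le_m : m <= s * b.+1 + c.
  rewrite -(leq_pmul2l p0); apply: leq_trans near _.
  by rewrite mulnDr leq_add2r mulnCA leq_mul2l ltnW ?orbT.
have u1 := sq_upper s (s * b) (m - s * b); rewrite subnKC // sq_multiple // in u1.
have u2 := sq_upper p (p * b) (q - p * b); rewrite subnKC // sq_multiple // in u2.
have l1 : sq (s + p) ((s + p) * b) <= sq (s + p) (m + q) by apply: leq_sq; rewrite mulnDl leq_add.
rewrite sq_multiple ?addn_gt0 ?s0 // in l1.
have b1 : (m - s * b) * (2 * (m %/ s)).+1 <= (s + c) * (2 * (m + q) + 1).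
  apply: leq_mul; first by move: le_m; rewrite mulnS; lia.
  by have := leq_div m s; lia.
have b2 : (q - p * b) * (2 * (q %/ p)).+1 <= p * (2 * (m + q) + 1).
  apply: leq_mul; first by move: lt_q; rewrite mulnS; lia.
  by have := leq_div q p; lia.
by clear -u1 u2 l1 b1 b2; lia.
Qed.

Lemma card_setD_ge (T : finType) (X S : {set T}) : #|X| <= #|X :\: S| + #|S|.
Proof. by rewrite -(cardsID S X) addnC leq_add2l subset_leq_card // subsetIr. Qed.

(** With K_r(2T) use [fine_step], otherwise [coarse_step]. If the coarse deletion destroys [heavy],
    then U was nearly balanced, and [erdos_stone] contradicts [nonadj G U U <= bnd M s p U]. *)
Lemma reduction_step s p h : 0 < p -> exists Q c,
  forall (V : finType) (G : sgraph V) (M U : {set V}),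
  (s = 0 -> M = set0) -> crit_free G U (s + p) h -> crit_free G (U :&: M) s h ->
  heavy M s p U -> Q <= #|U :\: M| -> nonadj G U U <= bnd M s p U ->
  structured G M s (s + p) U \/
  exists S : {set V}, [/\ S \subset U, 0 < #|S|, #|S| <= c,
    bnd M s p U + nonadj G (U :\: S) (U :\: S) < nonadj G U U + bnd M s p (U :\: S) &
    heavy M s p (U :\: S)].
Proof.
move=> p0; pose T := 2 * h + 2 + s; pose r := s + p.
have r0 : 0 < r by rewrite addn_gt0 p0 orbT.
have ltr : r.-1 < s + p by rewrite prednK.
have [c stepc] := coarse_step h (2 * T) p0 ltr.
have [Q1 coarse] := stepc 1; rewrite (prednK r0) in coarse.
(* The slope is chosen to beat the error (r + c)(2|U| + 1) of [bnd_near_balanced]. *)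
have [N0 es] := erdos_stone (2 * T) (3 * (r + c) + 1) r0.
exists (Q1 + N0 + p * T + 1), (c + r * T) => V G M U M0 cU cM hv leQ low.
have le_n : #|U :\: M| <= #|U| by apply/subset_leq_card/subsetDl.
have [K|noK] := has_blowup_dec G U r (2 * T).
  have [A bA mono] := mono_blowup M K.
  have [|||st|[S [SU S0 cS dS hS]]] := fine_step p0 M0 cU cM bA mono _ _ hv _.
  - by rewrite /T; lia.
  - by rewrite /T; lia.
  - by lia.
  - by left.
  by right; exists S; split=> //; apply: leq_trans cS (leq_addl _ _).
have [|S [SU S0 cS dS]] := coarse V G M U M0 cM hv _ noK; first by lia.
have [hS|nhS] := boolP (heavy M s p (U :\: S)).
  right; exists S; split=> //; first by apply: leq_trans cS (leq_addr _ _).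
  by rewrite addn1 in dS.
have s0 : 0 < s by rewrite lt0n; apply: contra nhS => /eqP s0; rewrite /heavy s0.
have near : p * #|U :&: M| <= s * #|U :\: M| + p * c.
  move: nhS; rewrite /heavy -ltnNge => lt.
  have le1 : #|U :\: S :\: M| <= #|U :\: M| by apply/subset_leq_card/setSD/subsetDl.
  have le2 : #|U :&: M| <= #|(U :\: S) :&: M| + c.
    have -> : (U :\: S) :&: M = (U :&: M) :\: S by rewrite !setDE setIAC.
    by apply: leq_trans (card_setD_ge _ S) _; rewrite leq_add2l.
  have : s * #|U :\: S :\: M| <= s * #|U :\: M| by rewrite leq_mul2l le1 orbT.
  have : p * #|U :&: M| <= p * (#|(U :\: S) :&: M| + c) by rewrite leq_mul2l le2 orbT.
  by rewrite mulnDr; lia.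
have := bnd_near_balanced p0 s0 hv near; have := es V G U _ noK; rewrite -/r.
have -> : N0 <= #|U| by lia.
have : (3 * (r + c) + 1) * #|U| = (r + c) * (2 * #|U| + 1) + (r + c) * (#|U|.-1) + #|U|.
  have -> : #|U| = #|U|.-1.+1 by rewrite prednK //; lia.
  by rewrite /=; ring.
by lia.
Qed.

(* Each reduction increases the excess bnd - nonadj by at least 1 and lowers
   #|U :\: M| by at most c, while the excess is bounded once #|U :\: M| < Q. *)
Lemma extremal_structure s p h C : 0 < p -> exists Q,
  forall (V : finType) (G : sgraph V) (M U : {set V}),
  (s = 0 -> M = set0) -> crit_free G U (s + p) h -> crit_free G (U :&: M) s h ->
  (forall W : {set V}, W \subset U :&: M -> sq s #|W| <= nonadj G W W + C) ->
  heavy M s p U -> Q <= #|U :\: M| -> nonadj G U U <= bnd M s p U ->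
  structured G M s (s + p) U.
Proof.
move=> p0; have [Q [c step]] := reduction_step s h p0.
pose B := c * (C + Q * Q) + Q.
exists (B + c + 1) => V G M U M0.
(* The potential c i + [#|W :\: M|], with i at most the excess, never drops under a reduction, and B
   bounds it once [#|W :\: M|] < Q. *)
have low n : forall W : {set V}, #|W| = n -> crit_free G W (s + p) h ->
    crit_free G (W :&: M) s h ->
    (forall X : {set V}, X \subset W :&: M -> sq s #|X| <= nonadj G X X + C) ->
    heavy M s p W -> forall i, 0 < i -> nonadj G W W + i <= bnd M s p W ->
    c * i + #|W :\: M| <= B.
  elim/ltn_ind: n => n IH W cW cU cM crude hv i i0 exc.
  have [leQ|ltQ] := leqP Q #|W :\: M|; last first.
    have : i <= C + Q * Q.
      have := crude _ (subxx _); have : nonadj G (W :&: M) (W :&: M) <= nonadj G W W.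
        by apply: leq_nonadj; exact: subsetIl.
      have := sq_le_square #|W :\: M| p0; move: exc; rewrite /bnd.
      have : #|W :\: M| * #|W :\: M| <= Q * Q by apply: leq_mul; exact: ltnW.
      by lia.
    move=> le_i; have : c * i <= c * (C + Q * Q) by rewrite leq_mul2l le_i orbT.
    by rewrite /B; lia.
  have [|st|[S [SW S0 cS dS hS]]] := step V G M W M0 cU cM hv leQ; first by lia.
    by have := structured_bnd p0 hv M0 st; lia.
  have cD : #|W :\: S| + #|S| = n.
    by have := cardsID S W; rewrite (setIidPr SW) cW addnC.
  have lt_n : #|W :\: S| < n by lia.
  have sDM : (W :\: S) :&: M \subset W :&: M by apply/setSI/subsetDl.
  have := IH _ lt_n (W :\: S) erefl _ _ _ hS i.+1 isT.
  have le_q : #|W :\: M| <= #|(W :\: S) :\: M| + c.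
    have -> : (W :\: S) :\: M = (W :\: M) :\: S by rewrite !setDE setIAC.
    by apply: leq_trans (card_setD_ge _ S) _; rewrite leq_add2l.
  move=> IH'; have := IH' (crit_freeS (subsetDl _ _) (leqnn h) cU).
  move=> /(_ (crit_freeS sDM (leqnn h) cM)) {}IH'.
  have := IH' (fun X sX => crude X (subset_trans sX sDM)).
  by rewrite mulnS; lia.
move=> cU cM crude hv leQ exc.
have [|//|[S [SW S0 cS dS hS]]] := step V G M U M0 cU cM hv _ exc.
  by rewrite /B in leQ; lia.
have sDM : (U :\: S) :&: M \subset U :&: M by apply/setSI/subsetDl.
have := low _ (U :\: S) erefl (crit_freeS (subsetDl _ _) (leqnn h) cU)
  (crit_freeS sDM (leqnn h) cM) (fun X sX => crude X (subset_trans sX sDM)) hS 1 isT.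
have le_q : #|U :\: M| <= #|(U :\: S) :\: M| + c.
  have -> : (U :\: S) :\: M = (U :\: M) :\: S by rewrite !setDE setIAC.
  by apply: leq_trans (card_setD_ge _ S) _; rewrite leq_add2l.
by lia.
Qed.

Lemma simonovits k h : 0 < k -> exists N,
  forall (V : finType) (G : sgraph V) (U : {set V}), crit_free G U k h -> N <= #|U| ->
  sq k #|U| <= nonadj G U U /\
  (nonadj G U U <= sq k #|U| -> structured G set0 0 k U).
Proof.
move=> k0; have [N ext] := extremal_structure 0 h 0 k0.
exists N => V G U cU leN.
have bndE (W : {set V}) : bnd set0 0 k W = sq k #|W|.
  by rewrite /bnd setI0 cards0 setD0 /sq big_ord0.
have st : nonadj G U U <= sq k #|U| -> structured G set0 0 k U.
  rewrite -bndE => low; apply: ext low => //; first exact: crit_free0.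
    by move=> W; rewrite setI0 subset0 => /eqP->; rewrite cards0 /sq big_ord0.
  by rewrite setD0.
split=> //; rewrite leqNgt; apply/negP => lt.
have := structured_bnd k0 _ _ (st (ltnW lt)); rewrite bndE leqNgt lt.
by rewrite /heavy mul0n => /(_ isT) h0; have := h0 (fun _ => erefl).
Qed.

(** * Edge counts, colourings and Turan numbers *)

Lemma double_nb_edges (V : finType) (G : sgraph V) :
  2 * nb_edges G + nonadj G setT setT = #|V| * #|V|.
Proof.
have -> : #|V| * #|V| = \sum_(p : V * V) 1 by rewrite sum1_card card_prod.
rewrite (bigID (fun p => adj G p.1 p.2)) /=; congr (_ + _); last first.
  rewrite nonadjE pair_big /= [RHS]big_mkcond /=; apply: eq_big => [p|p _]; first by rewrite !inE.
  by case: (adj G p.1 p.2).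
rewrite (partition_big (fun p => [set p.1; p.2]) (mem (edges G))) //=.
rewrite mulnC -sum_nat_const; apply: eq_bigr => e eG.
have /cards2P[a [b [ab eE]]] : #|e| == 2 by apply: (forall_inP (edges_card2 G)).
rewrite sum1_card (@eq_card _ _ (mem [set (a, b); (b, a)])).
  by rewrite cards2 xpair_eqE negb_and ab.
case=> x y; rewrite unfold_in /= !inE !xpair_eqE; apply/andP/orP.
  case=> xy /eqP exy; rewrite eE in exy.
  have xab : (x == a) || (x == b) by rewrite -in_set2 -exy set21.
  have yab : (y == a) || (y == b) by rewrite -in_set2 -exy set22.
  case/orP: xab xy => /eqP->; case/orP: yab => /eqP->; rewrite ?adj_irr // !eqxx; by [left | right].
by case=> /andP[/eqP-> /eqP->]; rewrite /adj ?[[set b; a]]setUC -eE eG eqxx.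
Qed.

Lemma nonadj_complete_partite (V : finType) (G : sgraph V) r (c : V -> 'I_r) :
  complete_partite G c ->
  nonadj G setT setT = \sum_i part_size c i * part_size c i.
Proof.
move=> cG; have e i : part_size c i = #|class c setT i|.
  by apply: eq_card => x; rewrite !inE.
under [RHS]eq_bigr do rewrite e.
rewrite sum_class_squares nonadjE; apply: eq_bigr => x _; apply: eq_bigr => y _.
by rewrite cG negbK.
Qed.

Lemma sum_part_size (V : finType) r (c : V -> 'I_r) : \sum_i part_size c i = #|V|.
Proof.
rewrite -sum1_card (partition_big c predT) //=; apply: eq_bigr => i _.
by rewrite /part_size -sum1_card; apply: eq_bigl => x; rewrite inE.
Qed.

Lemma double_turan k n : 0 < k -> 2 * t_ k n + sq k n = n * n.
Proof.
move=> k0; have [c [cG bal]] := turan_spec n k0.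
have := double_nb_edges (turan k n); rewrite card_ord (nonadj_complete_partite cG).
have cT : #|[set: 'I_k]| = k by rewrite cardsT card_ord.
have := @balanced_sum_squares _ [set: 'I_k] (part_size c).
rewrite cT => /(_ k0 bal); rewrite (eq_bigl _ _ (in_setT (T := _))) => ->.
by rewrite (eq_bigl _ _ (in_setT (T := _))) sum_part_size card_ord.
Qed.

Lemma colorableS (T : finType) (G : sgraph T) k l : k <= l -> colorable G k -> colorable G l.
Proof.
move=> le_kl /colorableP[c cP]; apply/colorableP; exists (fun x => widen_ord le_kl (c x)).
by move=> x y /cP; apply: contra => /eqP/(congr1 val) /= e; apply/eqP/val_inj.
Qed.

Lemma chiP (T : finType) (G : sgraph T) k : (chi G <= k) = colorable G k.
Proof.
rewrite /chi; case: ex_minnP => m cm mmin; apply/idP/idP => [le_mk|/mmin//].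
exact: colorableS cm.
Qed.

Lemma edge_critical_crit_at (T : finType) (G : sgraph T) k :
  edge_critical G -> chi G = k + 1 -> crit_at G k.
Proof.
case=> e eG lt cG; split; first by rewrite -chiP cG addn1 ltnn.
by exists e; rewrite // -chiP; move: lt; rewrite cG addn1.
Qed.

Lemma edge_endpoint (T : finType) (G : sgraph T) e : e \in edges G ->
  exists a b, a != b /\ e = [set a; b].
Proof.
move=> eG; have /cards2P[a [b [ab ->]]] : #|e| == 2 by apply: (forall_inP (edges_card2 G)).
by exists a, b.
Qed.

Lemma set2_eq_l (T : finType) (a b x y : T) : [set x; y] = [set a; b] -> a = x \/ a = y.
Proof.
move=> e; have : a \in [set x; y] by rewrite e set21.
by rewrite in_set2 => /orP[]/eqP; [left | right].
Qed.

(** Colour G minus both edges with k - 1 colours; a new colour on one end of e2 restores e2, so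
    deleting e1 alone leaves a k-colourable graph. *)
Lemma double_edge_critical_crit_at (T : finType) (G : sgraph T) k :
  double_edge_critical G -> chi G = k.+1 -> crit_at G k.
Proof.
case=> e1 [e2 [e1G e2G ne drop]] cG; split; first by rewrite -chiP cG ltnn.
exists e1 => //; have [a [b [ab e2E]]] := edge_endpoint e2G.
move: drop; rewrite cG addn2 => -[drop].
have k0 : k = (k.-1).+1 by rewrite -drop.
have /colorableP[c cP] : colorable (del_edges G [set e1; e2]) k.-1 by rewrite -chiP -drop.
rewrite k0; apply/colorableP.
exists (fun x => if x == a then ord0 else lift ord0 (c x)) => x y.
rewrite /adj /= !inE => /andP[ne1 xy].
have xny : x != y by apply: contraTneq xy => ->; rewrite -/(adj G y y) adj_irr.
have [xa|xa] := eqVneq x a; have [ya|ya] := eqVneq y a => //.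
  by rewrite xa ya eqxx in xny.
rewrite (inj_eq lift_inj); apply: cP; rewrite /adj /= !inE xy (negPf ne1) /= andbT.
by apply/eqP; rewrite e2E => /set2_eq_l[] /eqP; rewrite eq_sym ?(negPf xa) ?(negPf ya).
Qed.

(** The colour of the apex is absent from F, so colourings of the cone and of F differ by exactly
    one colour. *)
Lemma crit_at_join_K1 (T : finType) (F : sgraph T) k :
  crit_at F k -> crit_at (join F K1) k.+1.
Proof.
case=> nc [e eF ce]; split.
  apply: contra nc => /colorableP[c cP]; apply/colorableP.
  have ne x : c (inr tt) != c (inl x) by apply: cP; rewrite adj_join.
  have ex x : {i | c (inl x) = lift (c (inr tt)) i} by case: (unlift_some (ne x)) => i ->; exists i.
  exists (fun x => sval (ex x)) => x y xy; apply: contraTneq isT => exy.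
  have : c (inl x) != c (inl y) by apply: cP; rewrite adj_join.
  by rewrite (svalP (ex x)) (svalP (ex y)) exy eqxx.
have [a [b [ab eE]]] := edge_endpoint eF.
have ab' : adj (join F K1) (inl a) (inl b) by rewrite adj_join /= /adj -eE.
exists [set inl a; inl b]; first exact: ab'.
have /colorableP[c cP] := ce; apply/colorableP.
exists (fun u => if u is inl x then lift ord0 (c x) else ord0) => u v.
rewrite /adj /= !inE => /andP[nuv]; rewrite -/(adj (join F K1) u v) adj_join.
case: u v nuv => [x|[]] [y|[]] //= nuv.
  move=> xy; rewrite (inj_eq lift_inj); apply: cP; rewrite /adj /= !inE -/(adj F x y) xy andbT eE.
  apply: contra nuv => /eqP exy.
  have -> : [set inl x; inl y] = inl @: [set x; y] :> {set T + unit} by rewrite imsetU1 imset_set1.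
  by rewrite exy imsetU1 imset_set1.
by rewrite -/(adj K1 tt tt) adj_irr.
Qed.

Section Restriction.
Variables (V : finType) (G : sgraph V) (U : {set V}).

(** The induced subgraph, relabelled by ordinals so that [ex_number] applies to it. *)
Definition restrict : sgraph 'I_#|U| :=
  graph_of (fun i j => adj G (enum_val i) (enum_val j)).

Lemma adj_restrict i j : adj restrict i j = adj G (enum_val i) (enum_val j).
Proof. by rewrite adj_graph_of // => [? ?|?]; rewrite ?adj_irr // adj_sym. Qed.

Lemma nonadj_restrict : nonadj restrict setT setT = nonadj G U U.
Proof.
rewrite !nonadjE [RHS]big_enum_val; apply: eq_big => [i|i _]; first by rewrite inE.
rewrite [RHS]big_enum_val; apply: eq_big => [j|j _]; first by rewrite inE.
by rewrite adj_restrict.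
Qed.

Lemma subgraph_restrict (W : finType) (J : sgraph W) : subgraph J restrict ->
  exists f, hom_into G J U f.
Proof.
case/existsP=> f /andP[/injectiveP fI /forallP fP]; exists (fun x => enum_val (f x)).
split=> [x y /enum_val_inj/fI //|x|x y xy]; first exact: enum_valP.
by rewrite -adj_restrict; have /forallP/(_ y)/implyP := fP x; apply.
Qed.

Lemma leq_ex_number (W : finType) (J : sgraph W) : ~~ subgraph J restrict ->
  #|U| * #|U| <= nonadj G U U + 2 * ex_number #|U| J.
Proof.
move=> free; have := double_nb_edges restrict; rewrite card_ord nonadj_restrict.
have : nb_edges restrict <= ex_number #|U| J by apply: leq_bigmax_cond.
by lia.
Qed.

End Restriction.

Lemma hom_subgraph (V W : finType) (G : sgraph V) (J : sgraph W) X f :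
  hom_into G J X f -> subgraph J G.
Proof.
case=> fI _ fP; apply/existsP; exists [ffun x => f x]; apply/andP; split.
  by apply/injectiveP => x y; rewrite !ffunE => /fI.
by apply/forallP => x; apply/forallP => y; apply/implyP; rewrite !ffunE; exact: fP.
Qed.

Lemma subgraph_trans (T1 T2 T3 : finType) (G1 : sgraph T1) (G2 : sgraph T2) (G3 : sgraph T3) :
  subgraph G1 G2 -> subgraph G2 G3 -> subgraph G1 G3.
Proof.
case/existsP=> f /andP[/injectiveP fI /forallP fP] /existsP[g /andP[/injectiveP gI /forallP gP]].
apply: (@hom_subgraph _ _ _ _ setT (fun x => g (f x))); split=> [x y /gI/fI //|//|x y xy].
have /forallP/(_ (f y))/implyP := gP (f x); apply.
by have /forallP/(_ y)/implyP := fP x; apply.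
Qed.

Lemma free_induced (V W : finType) (G : sgraph V) (F : sgraph W) (M : {set V}) :
  graph_free F (induced G M) -> forall f, ~ hom_into G F M f.
Proof.
move=> /negP free f [fI fM fP]; apply: free.
apply: (@hom_subgraph _ _ _ _ setT (fun x => Sub (f x) (fM x))); split=> // [x y [/fI]|x y xy] //.
by rewrite adj_induced; exact: fP.
Qed.

Lemma turan_leq_ex_number (W : finType) (J : sgraph W) k q : 0 < k ->
  ~~ colorable J k -> t_ k q <= ex_number q J.
Proof.
move=> k0 nc; apply: leq_bigmax_cond; apply: contra nc.
case/existsP=> f /andP[_ /forallP fP]; apply/colorableP.
have [c [cG _]] := turan_spec q k0; exists (fun x => c (f x)) => x y xy.
by rewrite -cG; have /forallP/(_ y)/implyP := fP x; apply.
Qed.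

(** A single [q0] serves both the numerical bound and the structure of extremal sets, the latter for
    the case of equality. *)
Lemma ex_number_leq_turan (W : finType) (J : sgraph W) k : 0 < k -> crit_at J k ->
  exists q0, (forall q, q0 <= q -> ex_number q J <= t_ k q) /\
    forall (V : finType) (G : sgraph V) (U : {set V}), (forall f, ~ hom_into G J U f) ->
    q0 <= #|U| -> sq k #|U| <= nonadj G U U /\
      (nonadj G U U <= sq k #|U| -> structured G set0 0 k U).
Proof.
move=> k0 critJ; have [q0 sim] := simonovits #|W| k0; exists q0; split; last first.
  by move=> V G U free; apply: sim; apply: free_crit_free free.
move=> q leq; apply/bigmax_leqP => G /negP free.
have [||low _] := sim _ G setT; last 1 first.
- have := double_nb_edges G; have := double_turan q k0.
  by move: low; rewrite cardsT !card_ord; lia.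
- by apply: free_crit_free (leqnn _) critJ _ => f /hom_subgraph.
- by rewrite cardsT card_ord.
Qed.

(** * Few vertices outside M *)

Lemma nonadj_bipartition (V : finType) (G : sgraph V) (M : {set V}) :
  nonadj G setT setT = nonadj G M M + nonadj G (~: M) (~: M) + 2 * nonadj G M (~: M).
Proof.
have := nonadj_del G (subsetT M); rewrite setTD (nonadjC G setT M).
by rewrite (nonadjC G M setT) (nonadj_split G M (subsetT M)) setTD (nonadjC G (~: M) M); lia.
Qed.

(** At most Q vertices of M miss something outside M. Restoring them to the rest W raises [sq] by at
    most 2Q|W| plus a constant, whereas W without K_s(h) would have surplus (2Q + 1)|W|. *)
Lemma common_blowup s h Q : 0 < s -> exists n0,
  forall (V : finType) (G : sgraph V) (M : {set V}),
  n0 <= #|M| -> sq s #|M| <= nonadj G M M ->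
  nonadj G setT setT <= sq s #|M| + Q ->
  has_blowup G [set x in M | ~: M \subset nbr G x] s h.
Proof.
move=> s0; have [N es] := erdos_stone h (2 * Q + 1) s0.
exists (N + Q + Q * (2 * Q + 2) + 1) => V G M leM lowM low.
set W := [set x in M | _]; have WM : W \subset M by apply/subsetP => x; rewrite inE => /andP[].
have := nonadj_bipartition G M => dec.
have leD : #|M :\: W| <= Q.
  apply: (@leq_trans (nonadj G M (~: M))); last by lia.
  rewrite /nonadj (big_setID W) /= -sum1_card (leq_trans _ (leq_addl _ _)) //.
  apply: leq_sum => x; rewrite !inE => /andP[+ xM]; rewrite xM /= => nsub.
  by rewrite card_gt0 setD_eq0.
have [//|noK] := has_blowup_dec G W s h.
have eM := cardsID W M; rewrite (setIidPr WM) in eM.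
have := es V G W _ noK; have := leq_nonadj G WM WM.
have := sq_upper s #|W| #|M :\: W|; rewrite eM.
have : #|M :\: W| * (2 * (#|M| %/ s)).+1 <= Q * (2 * (#|W| + Q)).+1.
  by apply: leq_mul => //; have := leq_div #|M| s; lia.
have : (2 * Q + 1) * #|W| = 2 * Q * #|W| + #|W| by ring.
have : Q * (2 * (#|W| + Q)).+1 = 2 * Q * #|W| + Q * (2 * Q + 1) by ring.
have : Q * (2 * Q + 2) = Q * (2 * Q + 1) + Q by ring.
lia.
Qed.

(* F embeds in K_1 joined to K_s(h): send one end of its critical edge to K_1. *)
Lemma hom_join (V V1 VF : finType) (G : sgraph V) (F1 : sgraph V1) (F : sgraph VF)
    (M : {set V}) s h f : crit_at F s -> #|VF| <= h ->
  hom_into G (join F1 K1) (~: M) f ->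
  has_blowup G [set x in M | ~: M \subset nbr G x] s h ->
  exists g, hom_into G (join F1 F) setT g.
Proof.
move=> /crit_atP[a [b [c [ab _ cP]]]] le_h [fI fM fP] bA.
have {bA} [A [AW cA cpA]] := bA.
have [|g gA gI] := @fiberwise_injection V VF (fun x => A (c x)) (f (inr tt)).
  by move=> x; rewrite cA.
have gM x : g x \in M by have := subsetP (AW (c x)) _ (gA x); rewrite inE => /andP[].
have fg u x : adj G (f u) (g x).
  have := subsetP (AW (c x)) _ (gA x); rewrite inE => /andP[_ /subsetP/(_ (f u) (fM u))].
  by rewrite inE adj_sym.
have fNg u x : f u != g x.
  by apply/eqP => e; have := fM u; rewrite e inE gM.
have disj i j x : x \in A i -> x \in A j -> i = j.
  move=> xi xj; apply: contraTeq isT => ij.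
  by have := cpA i j (in_setT _) (in_setT _) ij x x xi xj; rewrite adj_irr.
have g_inj x y : g x = g y -> x = y.
  move=> e; apply: gI => //; congr (A _); apply: (disj _ _ (g x)) => //.
  by rewrite e.
have g_adj x y : adj F x y -> x != a -> y != a -> adj G (g x) (g y).
  move=> xy xa ya; apply: (cpA (c x) (c y)) => //; apply: cP => //.
  by apply/eqP => /set2_eq_l[] /eqP; rewrite eq_sym ?(negPf xa) ?(negPf ya).
pose e u := match u with
  | inl x => f (inl x)
  | inr x => if x == a then f (inr tt) else g x end.
exists e; split=> //.
  move=> [x|x] [y|y] /=.
  - by move=> /fI[->].
  - by case: eqP => _ => [/fI//|/eqP]; rewrite (negPf (fNg _ _)).
  - by case: eqP => _ => [/fI//|/esym/eqP]; rewrite (negPf (fNg _ _)).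
  case: eqP => [->|_]; case: eqP => [->|_] //.
  - by move/eqP; rewrite (negPf (fNg _ _)).
  - by move/esym/eqP; rewrite (negPf (fNg _ _)).
  - by move/g_inj->.
move=> [x|x] [y|y]; rewrite adj_join /=.
- by move=> xy; apply: fP; rewrite adj_join.
- by move=> _; case: eqP => _ //; apply: fP; rewrite adj_join.
- by move=> _; rewrite adj_sym; case: eqP => _ //; apply: fP; rewrite adj_join.
case: eqP => [->|/eqP xa]; case: eqP => [->|/eqP ya] xy //.
- by rewrite adj_irr in xy.
- by rewrite adj_sym.
exact: g_adj.
Qed.

(** * The case of equality *)

Lemma nonadj_proper_eq (V : finType) (G : sgraph V) r (c : V -> 'I_r) :
  (forall x y, c x = c y -> ~~ adj G x y) ->
  nonadj G setT setT <= \sum_i #|class c setT i| * #|class c setT i| ->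
  complete_partite G c.
Proof.
move=> cP low x y; have [cxy|cxy] := eqVneq (c x) (c y); first by rewrite (negPf (cP x y cxy)).
move: low; rewrite leqNgt; apply: contraNT => nxy.
have le u v : (c u == c v : nat) <= ~~ adj G u v by case: eqP => // /cP->.
rewrite sum_class_squares nonadjE (bigD1 x) //= [X in _ < X](bigD1 x) //= -addSn.
apply: leq_add; last by apply: leq_sum => u _; apply: leq_sum => v _.
rewrite (bigD1 y) //= [X in _ < X](bigD1 y) //= (negPf cxy) nxy add1n ltnS.
by apply: leq_sum => v _.
Qed.

(** All estimates become tight, so no pair between classes is missing. If d > 0 vertices outside M
    have a colour in I, shifting them was free, and a different choice of s classes has total size
    |M|. *)
Lemma structured_two_group (V : finType) (G : sgraph V) (M : {set V}) s p :
  0 < s -> 0 < p -> heavy M s p setT -> structured G M s (s + p) setT ->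
  nonadj G setT setT <= bnd M s p setT -> two_group_partite G (s + p) s #|M|.
Proof.
move=> s0 p0 hv [c [I [cI cP' cM]]] low.
have cP x y : c x = c y -> ~~ adj G x y by apply: cP'.
have M0 : s = 0 -> M = set0 by move=> e; rewrite e in s0.
have [d [e1 e2 le_bnd]] := structured_sq p0 hv erefl cI M0 cP' cM.
have le_N := class_squares_le cP'.
have cIC : #|~: I| = p by rewrite cardsCs setCK card_ord cI addKn.
have psE i : #|class c setT i| = part_size c i by apply: eq_card => x; rewrite !inE.
have PE (J : {set 'I_(s + p)}) : \sum_(i in J) #|class c setT i| = \sum_(i in J) part_size c i.
  by apply: eq_bigr.
have {}le_N : \sum_i part_size c i * part_size c i <= nonadj G setT setT.
  by apply: leq_trans le_N; apply: leq_sum => i _; rewrite psE.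
rewrite !PE setTI setTD in e1 e2 le_bnd.
have hq : s * #|~: M| <= p * #|M| by move: hv; rewrite /heavy setTI setTD.
have bE : bnd M s p setT = sq s #|M| + sq p #|~: M| by rewrite /bnd setTI setTD.
have q_def : #|~: M| = #|V| - #|M| by have := cardsC M; lia.
have sqI : sq s (#|M| + d) <= \sum_(i in I) part_size c i * part_size c i.
  by rewrite -e1 -{1}cI; apply: sq_sum_squares; rewrite cI.
have sqC : sq p (#|~: M| - d) <= \sum_(i in ~: I) part_size c i * part_size c i.
  by rewrite -e2 addnK -{1}cIC; apply: sq_sum_squares; rewrite cIC.
have split : \sum_i part_size c i * part_size c i =
    \sum_(i in I) part_size c i * part_size c i
    + \sum_(i in ~: I) part_size c i * part_size c i.
  rewrite (bigID (mem I)) /=; congr (_ + _).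
  by apply: eq_bigl => i; rewrite inE.
have comp : complete_partite G c.
  apply: nonadj_proper_eq cP _; under [X in _ <= X]eq_bigr do rewrite psE.
  by lia.
have [d0|d0] := posnP d.
  exists c, I; split=> //.
  - by rewrite cI cIC addKn.
  - by split; [rewrite e1 d0 addn0 | rewrite -q_def -e2 d0 addn0].
  - move=> i j iI jI.
    have sqle : \sum_(i in I) part_size c i * part_size c i <=
        sq #|I| (\sum_(i in I) part_size c i) by rewrite cI e1; lia.
    have I0 : 0 < #|I| by rewrite cI.
    have /andP[_ hi] := sq_sum_squares_eq I0 sqle iI.
    have /andP[hj _] := sq_sum_squares_eq I0 sqle jI.
    by apply: leq_trans hi _; rewrite ltnS.
  move=> i j iI jI.
  have sqle : \sum_(i in ~: I) part_size c i * part_size c i <=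
      sq #|~: I| (\sum_(i in ~: I) part_size c i).
    have -> : \sum_(i in ~: I) part_size c i = #|~: M| - d by lia.
    by rewrite cIC; lia.
  have I0 : 0 < #|~: I| by rewrite cIC.
  have /andP[_ hi] := sq_sum_squares_eq I0 sqle iI.
  have /andP[hj _] := sq_sum_squares_eq I0 sqle jI.
  by apply: leq_trans hi _; rewrite ltnS.
(* Here all the parts have size a or a + 1, and s of them are regrouped. *)
pose a := #|M| %/ s.
have qE : #|~: M| = (#|~: M| - d) + d by lia.
(* By convexity, shifting d > 0 vertices is free only if both group averages have the same floor. *)
have aE : #|~: M| %/ p = a.
  apply/eqP; rewrite eqn_leq; apply/andP; split.
    rewrite leq_divRL //; have := leq_divM #|~: M| p; nia.
  have l1 := sq_lower s #|M| d; have u1 := sq_upper p (#|~: M| - d) d.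
  rewrite -qE -/a in l1 u1.
  have : d * (2 * a).+1 <= d * (2 * (#|~: M| %/ p)).+1 by lia.
  by rewrite leq_pmul2l // ltnS leq_pmul2l.
have c1 := sq_closed #|M| s0; have c2 := sq_closed #|~: M| p0.
rewrite -/a aE in c1 c2.
have ge_m : s * a <= #|M| by rewrite mulnC leq_divM.
have ge_q : p * a <= #|~: M| by rewrite mulnC -aE leq_divM.
have lt_m : #|M| < s * a.+1 by rewrite mulnC -ltn_divLR.
have lt_q : #|~: M| < p * a.+1 by rewrite mulnC -ltn_divLR // aE.
have cV : #|V| = #|M| + #|~: M| by rewrite cardsC.
have r0 : 0 < s + p by rewrite addn_gt0 s0.
have aV : #|V| %/ (s + p) = a.
  apply/eqP; rewrite eqn_leq leq_divRL // -ltnS ltn_divLR // cV; apply/andP; split.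
    by rewrite mulnC mulnDl; lia.
  by rewrite mulnC mulnDl; lia.
have c3 := sq_closed #|V| r0; rewrite aV in c3.
have cT : #|[set: 'I_(s + p)]| = s + p by rewrite cardsT card_ord.
have sumT (F : 'I_(s + p) -> nat) : \sum_(i in [set: 'I_(s + p)]) F i = \sum_i F i.
  by apply: eq_bigl => i; rewrite inE.
(* With the common floor a, the two closed forms add up to [sq (s + p) #|V|], so all parts together
   are balanced. *)
have sizes i : a <= part_size c i <= a.+1.
  have := @sq_sum_squares_eq _ [set: 'I_(s + p)] (part_size c).
  rewrite cT !sumT sum_part_size aV => /(_ r0) h; apply: h; last by rewrite inE.
  have : sq (s + p) #|V| = sq s #|M| + sq p #|~: M|.
    by move: c3; rewrite cV; clear -c1 c2; lia.
  by lia.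
pose Big := [set i | part_size c i == a.+1].
have partE i : part_size c i = a + (i \in Big).
  by rewrite inE; have := sizes i; case: eqP => [->|]; lia.
have sumE (J : {set 'I_(s + p)}) : \sum_(i in J) part_size c i = #|J| * a + #|J :&: Big|.
  rewrite (eq_bigr _ (fun i _ => partE i)) big_split /= sum_nat_const; congr (_ + _).
  rewrite -sum1_card big_mkcond [RHS]big_mkcond; apply: eq_bigr => i _ /=.
  by rewrite in_setI; case: (i \in J); case: (i \in Big).
have cBig : #|V| = (s + p) * a + #|Big|.
  by have := sumE setT; rewrite sumT sum_part_size cT setTI.
have cCBig : #|Big| + #|~: Big| = s + p by rewrite cardsC card_ord.
rewrite mulnS in lt_m; rewrite mulnS in lt_q; rewrite mulnDl in cBig.
(* The new group has |M| - sa parts of size a + 1, filled up to s parts with parts of size a. *)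
have [B1 sB1 cB1] : exists2 B : {set _}, B \subset Big & #|B| = #|M| - s * a.
  by apply: subset_of_card; lia.
have [B2 sB2 cB2] : exists2 B : {set _}, B \subset ~: Big & #|B| = s - (#|M| - s * a).
  by apply: subset_of_card; lia.
have B12 : B1 :&: B2 = set0.
  apply/setP => i; rewrite !inE; apply/negP => /andP[/(subsetP sB1) iB /(subsetP sB2)].
  by rewrite inE iB.
have cB : #|B1 :|: B2| = s by rewrite cardsU B12 cards0 cB1 cB2; lia.
have BBig : (B1 :|: B2) :&: Big = B1.
  apply/setP => i; rewrite !inE; have := subsetP sB1 i; have := subsetP sB2 i.
  rewrite !inE; case: (i \in B1); case: (i \in B2) => //=; first by move=> _ ->.
    by move=> _ ->.
  by move=> /(_ isT) /negPf->.
have sumB : \sum_(i in B1 :|: B2) part_size c i = #|M|.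
  by rewrite sumE cB BBig cB1; lia.
have bal (J : {set 'I_(s + p)}) : as_equal_as_possible c J.
  by move=> i j _ _; have := sizes i; have := sizes j; lia.
have cBC : #|~: (B1 :|: B2)| = s + p - s by rewrite cardsCs setCK card_ord cB.
exists c, (B1 :|: B2); split=> //; split=> //.
have := sum_part_size c; rewrite (bigID (mem (B1 :|: B2))) /= sumB => e.
rewrite -[LHS](addKn #|M|) -e; congr (_ + _ - _); apply: eq_bigl => i.
by rewrite inE.
Qed.

Lemma two_group_nonadj (V : finType) (G : sgraph V) s p m :
  0 < s -> 0 < p -> two_group_partite G (s + p) s m ->
  nonadj G setT setT = sq s m + sq p (#|V| - m).
Proof.
move=> s0 p0 [c [I [comp [cI cIC] [eI eIC] bI bIC]]]; rewrite addKn in cIC.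
rewrite (nonadj_complete_partite comp) (bigID (mem I)) /=; congr (_ + _).
  by rewrite (balanced_sum_squares _ bI) cI ?eI.
under eq_bigl do rewrite -in_setC.
by rewrite (balanced_sum_squares _ bIC) cIC ?eIC.
Qed.

(** * Combining the regimes of few and many vertices outside M *)

Lemma ceil_ratio_le (a b c : nat) : 0 < b ->
  (Num.ceil (a%:R / b%:R : rat) <= c%:Z)%R -> a <= b * c.
Proof.
move=> b0; rewrite Num.Theory.ceil_le_int Num.Theory.ler_pdivrMr ?Num.Theory.ltr0n //.
by rewrite -GRing.natrM Num.Theory.ler_nat mulnC.
Qed.

Lemma structured_setT (V : finType) (G : sgraph V) (M : {set V}) s p :
  structured G set0 0 s M -> structured G set0 0 p (~: M) ->
  structured G M s (s + p) setT.
Proof.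
move=> [c1 [_ [_ c1P _]]] [c2 [_ [_ c2P _]]].
exists (fun x => if x \in M then lshift p (c1 x) else rshift s (c2 x)).
exists [set lshift p i | i in setT]; split.
- by rewrite card_imset ?cardsT ?card_ord //; exact: lshift_inj.
- move=> x y _ _; case: ifPn => xM; case: ifPn => yM.
  + by move/lshift_inj; exact: c1P.
  + by move/eqP; rewrite eq_lrshift.
  + by move/eqP; rewrite eq_rlshift.
  + by move/rshift_inj; apply: c2P; rewrite inE.
by move=> x /setIP[_ ->]; exact: imset_f.
Qed.

Lemma hom_restrict (V W : finType) (G : sgraph V) (U : {set V}) (J : sgraph W) f :
  hom_into G J U f -> subgraph J (restrict G U).
Proof.
case=> fI fU fP; apply: (@hom_subgraph _ _ _ _ setT (fun x => enum_rank_in (fU x) (f x))).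
split=> [x y e|//|x y xy].
  by apply: fI; rewrite -(enum_rankK_in (fU x) (fU x)) e enum_rankK_in.
by rewrite adj_restrict !enum_rankK_in //; exact: fP.
Qed.

Theorem theorem2 (r s : nat) (hs : 2 <= s) (hsr : s < r) (hrs : 2 <= r - s)
    (V1 : finType) (F1 : sgraph V1)
    (hF1 : edge_critical F1) (hchiF1 : chi F1 = r - s) :
  exists q0 : nat,
    forall (VH : finType) (H : sgraph VH) (VF : finType) (F : sgraph VF),
      double_edge_critical H -> chi H = r + 1 ->
      edge_critical F -> chi F = s + 1 ->
      subgraph H (join F1 F) ->
  exists n0 : nat,
    forall n : nat, n0 <= n ->
    forall (V : finType) (G : sgraph V), #|V| = n -> graph_free H G ->
    forall (M : {set V}) (m : nat), #|M| = m -> graph_free F (induced G M) ->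
      (Num.ceil ((s * n)%:R / r%:R : rat) <= m%:Z)%R ->
      nb_edges G <= m * (n - m) + t_ s m + ex_number (n - m) (join F1 K1)
      /\ (q0 <= n - m ->
          nb_edges G <= m * (n - m) + t_ s m + t_ (r - s) (n - m)
          /\ (nb_edges G = m * (n - m) + t_ s m + t_ (r - s) (n - m)
              <-> two_group_partite G r s m)).
Proof.
have [p rE] : exists p, r = s + p by exists (r - s); rewrite subnKC // ltnW.
subst r; rewrite addKn in hrs hchiF1 *.
have s0 : 0 < s := ltnW hs; have p0 : 0 < p := ltnW hrs.
have sp0 : 0 < s + p by rewrite addn_gt0 s0.
have critJ : crit_at (join F1 K1) p.
  have pE : p = p.-1.+1 by rewrite prednK.
  rewrite pE; apply/crit_at_join_K1/edge_critical_crit_at => //.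
  by rewrite hchiF1 addn1.
(* [q0] comes from J0 and p alone, before H and F are introduced. *)
have [q0 [ex_le simJ]] := ex_number_leq_turan p0 critJ.
exists q0 => VH H VF F dH chiH eF chiF HF.
have critH : crit_at H (s + p) by apply: double_edge_critical_crit_at => //; rewrite chiH addn1.
have critF : crit_at F s by apply: edge_critical_crit_at.
pose h := #|VH| + #|VF|.
have [NF simF] := simonovits h s0.
(* [simF] bounds subsets of M with at least NF vertices; for smaller W, [sq s #|W|] is at most
   NF^2. *)
have [Q ext] := extremal_structure s h (NF * NF) p0.
have [m0 common] := common_blowup h (Q * Q) s0.
(* Since m >= sn / (s + p), this forces |M| >= NF + m0. *)
exists ((s + p) * (NF + m0)) => n le_n V G cV freeH M m cM freeF /(ceil_ratio_le sp0) le_m.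
subst n m.
have cU : crit_free G setT (s + p) h.
  by apply: free_crit_free critH _ => [|f /hom_subgraph]; [exact: leq_addr | apply/negP].
have cMF : crit_free G M s h.
  by apply: free_crit_free critF (free_induced freeF); exact: leq_addl.
have qE : #|V| - #|M| = #|~: M| by rewrite -(cardsC M) addKn.
rewrite qE.
have hv : heavy M s p setT.
  by rewrite /heavy setTI setTD; move: le_m; rewrite -(cardsC M); lia.
have large_m : NF + m0 <= #|M|.
  rewrite -(leq_pmul2l sp0); apply: leq_trans le_n _; apply: leq_trans le_m.
  exact: leq_pmull.
have bE : bnd M s p setT = sq s #|M| + sq p #|~: M| by rewrite /bnd setTI setTD.
have [lowM stM] : sq s #|M| <= nonadj G M M /\
    (nonadj G M M <= sq s #|M| -> structured G set0 0 s M).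
  by apply: simF => //; lia.
have M0 : s = 0 -> M = set0 by move=> e; rewrite e in s0.
have dG := double_nb_edges G; have dM := double_turan #|M| s0.
have dC := double_turan #|~: M| p0.
have sqV : #|V| * #|V| = #|M| * #|M| + 2 * (#|M| * #|~: M|) + #|~: M| * #|~: M|.
  by rewrite -(cardsC M); ring.
have t_ex : t_ p #|~: M| <= ex_number #|~: M| (join F1 K1).
  by apply: turan_leq_ex_number => //; case: critJ.
have large : Q <= #|~: M| -> bnd M s p setT <= nonadj G setT setT /\
    (nonadj G setT setT <= bnd M s p setT -> structured G M s (s + p) setT).
  move=> leQ; have st : nonadj G setT setT <= bnd M s p setT -> structured G M s (s + p) setT.
    apply: ext => //; [by rewrite setTI| |by rewrite setTD].
    move=> W; rewrite setTI => sWM; have [leW|ltW] := leqP NF #|W|.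
      have [lowW _] := simF V G W (crit_freeS sWM (leqnn h) cMF) leW.
      exact: leq_trans lowW (leq_addr _ _).
    apply: leq_trans (sq_le_square _ s0) _; apply: leq_trans (leq_addl _ _).
    by apply: leq_mul; exact: ltnW.
  split=> //; rewrite leqNgt; apply/negP => lt.
  by have := structured_bnd p0 hv M0 (st (ltnW lt)); rewrite leqNgt lt.
(* For #|~: M| < Q, a copy of J0 outside M forces H, unless many cross pairs are missing. *)
have small f : #|~: M| < Q -> hom_into G (join F1 K1) (~: M) f ->
    sq s #|M| + #|~: M| * #|~: M| < nonadj G setT setT.
  move=> ltQ homf; rewrite ltnNge; apply/negP => low.
  have [||g homg] := hom_join critF (leq_addl #|VH| _) homf (common V G M _ lowM _).
  - by lia.
  - apply: leq_trans low _; rewrite leq_add2l.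
    by apply: leq_mul; exact: ltnW.
  by case/negP: freeH; apply: subgraph_trans HF (hom_subgraph homg).
have dec := nonadj_bipartition G M.
have le_sqC := sq_le_square #|~: M| p0.
have back : two_group_partite G (s + p) s #|M| ->
    nb_edges G = #|M| * #|~: M| + t_ s #|M| + t_ p #|~: M|.
  by move=> /(two_group_nonadj s0 p0); rewrite qE; lia.
(* The split is at Q, which may depend on H and F, and not at [q0]. From Q on, both bounds follow
   from the structure, as [ex_number] is at least the Turan number. *)
have [leQ|ltQ] := leqP Q #|~: M|.
  have [low st] := large leQ; rewrite bE in low st.
  split; first by lia.
  move=> le_q; split; first by lia.
  split=> [eG|]; last exact: back.
  have le : nonadj G setT setT <= sq s #|M| + sq p #|~: M| by lia.
  apply: structured_two_group => //; first exact: st.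
  by rewrite bE.
(* A copy of J0 outside M pushes e(G) below the bound that counts no edge outside M; without a copy,
   [ex_number] bounds the edges there. *)
have [/subgraph_restrict[f homf]|free] := boolP (subgraph (join F1 K1) (restrict G (~: M))).
  have lt := small f ltQ homf; split; first by lia.
  by move=> le_q; split; [lia | split=> [eG|]; [lia | exact: back]].
have le_ex := leq_ex_number free; split; first by lia.
move=> le_q; have := ex_le _ le_q; split; first by lia.
split=> [eG|]; last exact: back.
have [lowC stC] : sq p #|~: M| <= nonadj G (~: M) (~: M) /\
    (nonadj G (~: M) (~: M) <= sq p #|~: M| -> structured G set0 0 p (~: M)).
  by apply: simJ => // f homf; case/negP: free; exact: hom_restrict homf.
apply: structured_two_group => //; last by rewrite bE; lia.
(* Equality makes M and its complement extremal separately, and their colourings are glued with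
   disjoint palettes. *)
by apply: structured_setT; [apply: stM | apply: stC]; lia.
Qed.
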